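(* Let $x_e\in\mathbb{R}^n$. Assume that $\mathcal{B}(x_e)\cap\operatorname{int}\Omega(x_e)\neq\emptyset$ and that the system $(\mathcal{F},\Omega)$ satisfies the Lie Algebra Rank Condition at $x_e$. Then $(\mathcal{F},\Omega)$ is locally accessible from $x_e$ under $\Omega$.
   Context: Let $\mathcal{F}=\{f_0,g_1,\dots,g_m\}$ be vector fields on $\mathbb{R}^n$, smooth ($C^\infty$) so that all iterated Lie brackets are defined. The system $(\mathcal{F},\Omega)$ is $$\dot x(t)=f_0(x(t))+\sum_{i=1}^m u_i(t)g_i(x(t)),\qquad u(t)\in\Omega(x(t)),\qquad \Omega(x)=\prod_{i=1}^m[\underline u_i(x),\overline u_i(x)]\subset\mathbb{R}^m .$$ Standing assumptions: $\underline u_i,\overline u_i:\mathbb{R}^n\to\mathbb{R}$ are continuous with $\underline u_i(x)<\overline u_i(x)$ for all $x,i$, and either $0<\underline u_i(x)$ for all $x,i$, or $\overline u_i(x)<0$ for all $x,i$. Admissible balancing set: $\mathcal{B}(x_e):=\{u\in\Omega(x_e):f_0(x_e)+\sum_{i=1}^m u_ig_i(x_e)=0\}$. Lie Algebra Rank Condition at $x_e$: with $\mathcal{L}(\mathcal{F})$ the smallest Lie algebra of vector fields containing $\mathcal{F}$ (closed under Lie brackets), the subspace $\mathcal{L}(\mathcal{F})(x_e)=\{X(x_e):X\in\mathcal{L}(\mathcal{F})\}$ equals $\mathbb{R}^n$. Admissible trajectory: an absolutely continuous $x:[0,T]\to\mathbb{R}^n$ for which there is $u\in L^\infty(0,T;\mathbb{R}^m)$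 with $u(t)\in\Omega(x(t))$ and the differential equation holding for a.e. $t$. Reachable set: for an open neighborhood $\mathcal{N}$ of $x_e$ and $T>0$, $\mathcal{R}_{\mathcal{F}}^\Omega(\le T,x_e;\mathcal{N})$ is the union of $\{x_e\}$ and the set of all $x(\tau)$ with $0<\tau\le T$ and $x:[0,\tau]\to\mathcal{N}$ an admissible trajectory with $x(0)=x_e$. Locally accessible from $x_e$ under $\Omega$: there is an open neighborhood $\mathcal{N}$ of $x_e$ such that $\mathcal{R}_{\mathcal{F}}^\Omega(\le T,x_e;\mathcal{N})$ has non-empty interior in $\mathbb{R}^n$ for every $T>0$. *)

(* Defs.v *)
From HB Require Import structures.
From mathcomp Require Import all_boot all_order all_algebra.
From mathcomp Require Import all_classical all_reals all_analysis.

Set Implicit Arguments.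
Unset Strict Implicit.
Unset Printing Implicit Defensive.

Import Order.TTheory GRing.Theory Num.Theory.
Import numFieldNormedType.Exports.

Local Open Scope classical_set_scope.
Local Open Scope ring_scope.

(* R^n is the row space 'rV[R]_n, whose library norm is the sup norm. It yields
   the usual topology, derivatives and absolutely continuous functions.
   A vector field on R^n is a map 'rV[R]_n -> 'rV[R]_n. *)

Section Fields.
Context {R : realType}.

Fixpoint Ck {V W : normedModType R} (k : nat) (f : V -> W) : Prop :=
  if k is k'.+1 then
    (forall x, differentiable f x) /\ (forall v, Ck k' ('D_v f))
  else continuous f.

Definition smooth {V W : normedModType R} (f : V -> W) : Prop :=
  forall k, Ck k f.

Context {n : nat}.
Local Notation vfield := ('rV[R]_n -> 'rV[R]_n).

(* [X, Y](x) = DY(x) X(x) - DX(x) Y(x) *)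
Definition lie_bracket (X Y : vfield) : vfield :=
  fun x => 'd Y x (X x) - 'd X x (Y x).

Definition lie_algebra (L : set vfield) : Prop :=
  [/\ L `<=` smooth,
      L (cst 0),
      forall X Y, L X -> L Y -> L (X \+ Y),
      forall (a : R) X, L X -> L (fun x => a *: X x)
    & forall X Y, L X -> L Y -> L (lie_bracket X Y)].

Definition lie_closure (F : set vfield) : set vfield := smallest lie_algebra F.

Definition LARC (F : set vfield) (xe : 'rV[R]_n) : Prop :=
  [set X xe | X in lie_closure F] = [set: 'rV[R]_n].

Definition abs_continuous (a b : R) (f : R -> 'rV[R]_n) : Prop :=
  forall e : R, 0 < e -> exists2 d : R, 0 < d &
    forall (k : nat) (s t : 'I_k -> R),
      (forall i, a <= s i /\ s i <= t i /\ t i <= b) ->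
      trivIset [set: 'I_k] (fun i => `]s i, t i[%classic) ->
      \sum_(i < k) (t i - s i) < d ->
      \sum_(i < k) `|f (t i) - f (s i)| < e.

End Fields.

Section System.
Context {R : realType} {n m : nat}.
Variables (f0 : 'rV[R]_n -> 'rV[R]_n) (g : 'I_m -> 'rV[R]_n -> 'rV[R]_n).
Variables (ulo uhi : 'I_m -> 'rV[R]_n -> R).

Definition sys_fields : set ('rV[R]_n -> 'rV[R]_n) := [set f0] `|` range g.

Definition Omega (x : 'rV[R]_n) : set 'rV[R]_m :=
  [set u | forall i, ulo i x <= u 0 i <= uhi i x].

Definition rhs (x : 'rV[R]_n) (u : 'rV[R]_m) : 'rV[R]_n :=
  f0 x + \sum_(i < m) u 0 i *: g i x.

Definition balancing (xe : 'rV[R]_n) : set 'rV[R]_m :=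
  [set u | Omega xe u /\ rhs xe u = 0].

(* Componentwise, u is extended by 0 outside ]0, T[; the Borel measurability
   required by Lfun is no restriction on classes of L^infty(0, T; R^m). *)
Definition Linfty (T : R) (u : R -> 'rV[R]_m) : Prop :=
  forall i, (fun t => u t 0 i) \_ `]0, T[ \in Lfun (@lebesgue_measure R) +oo%E.

(* x is a total function on R, but only its restriction to [0, T] matters:
   the differential equation is imposed a.e. on the open interval. *)
Definition admissible_trajectory (T : R) (x : R -> 'rV[R]_n) : Prop :=
  abs_continuous 0 T x /\
  exists2 u : R -> 'rV[R]_m, Linfty T u &
    {ae @lebesgue_measure R, forall t, t \in `]0, T[ ->
       Omega (x t) (u t) /\ is_derive t 1 x (rhs (x t) (u t))}.

Definition reachable (T : R) (xe : 'rV[R]_n) (N : set 'rV[R]_n) :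
    set 'rV[R]_n :=
  [set xe] `|`
  [set y | exists (tau : R) (x : R -> 'rV[R]_n),
     [/\ 0 < tau <= T, admissible_trajectory tau x,
         forall t, t \in `[0, tau] -> N (x t), x 0 = xe & x tau = y]].

Definition locally_accessible (xe : 'rV[R]_n) : Prop :=
  exists N : set 'rV[R]_n, open_nbhs xe N /\
    forall T : R, 0 < T -> (reachable T xe N)° !=set0.

End System.

(* Main.v *)
Require Import Defs.
From HB Require Import structures.
From mathcomp Require Import all_boot all_order all_algebra.
From mathcomp Require Import all_classical all_reals all_analysis.
From mathcomp Require Import ring lra.
Set Implicit Arguments.
Unset Strict Implicit.
Unset Printing Implicit Defensive.

Import Order.TTheory GRing.Theory Num.Theory.
Import numFieldNormedType.Exports.
Local Open Scope classical_set_scope.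
Local Open Scope ring_scope.

(* This is Krener's theorem, proved by growing the dimension of the reachable set.

   Constant controls u0 and u0 + eps e_i near the interior balancing control are
   admissible on a neighborhood of xe, and the corresponding frozen fields have
   the same linear span as f_0, g_1, ..., g_m. Concatenating their flows gives
   maps G from R^k into the set of points reached before time T. Consider such a
   G, differentiable at p with injective derivative L. If no (k+1)-dimensional
   one exists, then each frozen field X is tangent to all the k-dimensional ones,
   for otherwise the flow time of X could be added to the parameters. If a field Y
   is tangent to all of them, it is tangent along their images by the flow of X;
   pulling back by this flow and differentiating at time 0 shows that [X, Y] is
   tangent too. By the Jacobi identity the whole Lie algebra is then tangent, and
   the rank condition, which holds near xe, forces k = n. For k = n the inverse
   function argument yields an interior point.

   Differentiability is understood in the strict sense (G a - G b is close to
   (a - b) L for all a and b near p): it composes well, and it is what the inverse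
   function argument and the estimates on flows need and give. *)

(** * Matrix norms and mean value inequalities *)

Section EpsilonDelta.
Context {R : realType}.

Lemma nbhs_distP {V : normedModType R} (x : V) (P : set V) :
  nbhs x P <-> exists2 d : R, 0 < d & forall y, `|x - y| < d -> P y.
Proof.
by split=> [/nbhs_normP[d d0 dP]|[d d0 dP]]; [exists d|apply/nbhs_normP; exists d].
Qed.

Lemma continuous_distP {V W : normedModType R} (f : V -> W) (x : V) :
  {for x, continuous f} <-> forall e : R, 0 < e ->
    exists2 d : R, 0 < d & forall y, `|x - y| < d -> `|f x - f y| < e.
Proof.
split=> [/cvgrPdist_lt h e /h/nbhs_distP //|h].
by apply/cvgrPdist_lt => e /h/nbhs_distP.
Qed.

Lemma lip_continuous {V W : normedModType R} (f : V -> W) (K : R) :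
  (forall x y, `|f x - f y| <= K * `|x - y|) -> continuous f.
Proof.
move=> fK x; apply/continuous_distP => e e0.
have K1 : 0 < `|K| + 1 by rewrite ltr_wpDl.
exists (e / (`|K| + 1)) => [|y xy]; first by rewrite divr_gt0.
apply: (@le_lt_trans _ _ ((`|K| + 1) * `|x - y|)).
  rewrite (le_trans (fK _ _))// ler_wpM2r// (le_trans (ler_norm _))//.
  by rewrite lerDl.
by rewrite mulrC -ltr_pdivlMr.
Qed.

End EpsilonDelta.

Section MatrixNorm.
Context {R : realType}.

Lemma mx_coord_le {m n : nat} (A : 'M[R]_(m, n)) i j : `|A i j| <= `|A|.
Proof.
rewrite [leRHS]/Num.Def.normr/= mx_normrE.
exact: (le_bigmax _ (fun ij => `|A ij.1 ij.2|) (i, j)).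
Qed.

Lemma mx_norm_leP {m n : nat} (A : 'M[R]_(m, n)) (c : R) : 0 <= c ->
  (forall i j, `|A i j| <= c) -> `|A| <= c.
Proof.
by move=> c0 Ac; rewrite /Num.Def.normr/= mx_normrE (bigmax_le _ c0).
Qed.

Lemma mulmx_norm_le {m n p : nat} (A : 'M[R]_(m, n)) (B : 'M[R]_(n, p)) :
  `|A *m B| <= n%:R * `|A| * `|B|.
Proof.
apply: mx_norm_leP => [|i j]; first by rewrite !mulr_ge0.
rewrite mxE (le_trans (ler_norm_sum _ _ _))//.
have -> : n%:R * `|A| * `|B| = \sum_(k < n) `|A| * `|B|.
  by rewrite sumr_const card_ord -mulrA mulr_natl.
by apply: ler_sum => k _; rewrite normrM ler_pM// mx_coord_le.
Qed.

Lemma cvg_mxP {T : Type} {F : set_system T} {FF : Filter F} {m n : nat}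
    (f : T -> 'M[R]_(m, n)) (l : 'M[R]_(m, n)) :
  (forall i j, f x i j @[x --> F] --> l i j) -> f x @[x --> F] --> l.
Proof.
move=> fl; apply/cvgrPdist_le => e e0; near=> x.
apply: mx_norm_leP (ltW e0) _ => i j; rewrite !mxE; move: i j.
suff : forall ij : 'I_m * 'I_n, `|l ij.1 ij.2 - f x ij.1 ij.2| <= e.
  by move=> h i j; have := h (i, j).
near: x; apply: filter_forall => -[i j]/=.
exact: (cvgrPdist_le _ _).1 (fl i j) _ e0.
Unshelve. all: by end_near. Qed.

Lemma is_derive_mxP {V : normedModType R} {m n : nat} (f : V -> 'M[R]_(m, n))
    (t v : V) (df : 'M[R]_(m, n)) :
  is_derive t v f df <-> forall i j, is_derive t v (fun x => f x i j) (df i j).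
Proof.
split=> [[dft fE] i j|df_].
  have := (derivable_mxP f t v).1 dft i j => dfij.
  by apply: DeriveDef => //; rewrite -fE derive_mx// mxE.
have dft : derivable f t v by apply/derivable_mxP => i j; case: (df_ i j).
apply: DeriveDef => //; rewrite derive_mx//; apply/matrixP => i j.
by rewrite mxE; case: (df_ i j).
Qed.

Lemma is_derive_continuous {V : normedModType R} (f : R -> V) (t : R) (df : V) :
  is_derive t 1 f df -> {for t, continuous f}.
Proof. by case=> /derivable1_diffP/differentiable_continuous. Qed.

Lemma is_derive_diff_comp {V W : normedModType R} (f : V -> W) (x : R -> V)
    (t : R) (v : V) :
  is_derive t 1 x v -> differentiable f (x t) ->
  is_derive t 1 (f \o x) ('d f (x t) v).
Proof.
move=> [dx <-] df; have /derivable1_diffP dx' := dx.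
have dfx : differentiable (f \o x) t by exact: differentiable_comp.
apply: DeriveDef; first exact/derivable1_diffP.
by rewrite !deriveE// diff_comp.
Qed.

Lemma is_derive_mulmx {m n p : nat} (A : R -> 'M[R]_(m, n))
    (B : R -> 'M[R]_(n, p)) (t : R) dA dB :
  is_derive t 1 A dA -> is_derive t 1 B dB ->
  is_derive t 1 (fun s => A s *m B s) (dA *m B t + A t *m dB).
Proof.
move=> /is_derive_mxP hA /is_derive_mxP hB; apply/is_derive_mxP => i j.
rewrite (_ : (fun s => _) = \sum_(k < n) ((fun s => A s i k) * (fun s => B s k j))).
  apply: is_derive_eq; rewrite !mxE -big_split/=; apply: eq_bigr => k _.
  by rewrite addrC; congr (_ + _); rewrite /GRing.scale/= mulrC.
by apply/funext => s; rewrite mxE fct_sumE.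
Qed.

Lemma norm_MVT_segment {m n : nat} (f df : R -> 'M[R]_(m, n)) (a b C : R) :
  a <= b ->
  (forall t : R, a <= t <= b -> is_derive t 1 f (df t)) ->
  (forall t, a <= t <= b -> `|df t| <= C) ->
  `|f b - f a| <= C * (b - a).
Proof.
move=> ab dfE dfC.
have C0 : 0 <= C by rewrite (le_trans _ (dfC a _))// lexx ab.
apply: mx_norm_leP => [|i j]; first by rewrite mulr_ge0// subr_ge0.
have dfij u : u \in `[a, b] -> is_derive u 1 (fun x => f x i j : R) (df u i j).
  by rewrite in_itv/= => /dfE/is_derive_mxP.
have fc : {within `[a, b], continuous (fun x => f x i j : R)}.
  by apply: derivable_within_continuous => u /dfij[].
have dfo u : u \in `]a, b[ -> is_derive u 1 (fun x => f x i j : R) (df u i j).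
  by move=> /subset_itv_oo_cc; exact: dfij.
have [u uin fE] := @MVT_segment R (fun x => f x i j) (fun x => df x i j) a b ab dfo fc.
rewrite !mxE fE normrM (@ger0_norm _ (b - a)) ?subr_ge0// ler_wpM2r ?subr_ge0//.
by apply: le_trans (mx_coord_le _ _ _) (dfC _ _); rewrite in_itv in uin.
Qed.

Lemma norm_MVT {m n : nat} (f df : R -> 'M[R]_(m, n)) (c C : R) :
  (forall t : R, `|t| < c -> is_derive t 1 f (df t)) ->
  (forall t, `|t| < c -> `|df t| <= C) ->
  forall s t, `|s| < c -> `|t| < c -> `|f t - f s| <= C * `|t - s|.
Proof.
move=> dfE dfC s t sc tc.
wlog st : s t sc tc / s <= t.
  move=> h; have /orP[] := le_total s t => ?; first exact: h.
  by rewrite distrC [in leRHS]distrC h.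
have itvc u : s <= u <= t -> `|u| < c.
  move: sc tc; rewrite !ltr_norml => /andP[a1 _] /andP[_ a2] /andP[b1 b2].
  by rewrite (lt_le_trans a1 b1) (le_lt_trans b2 a2).
rewrite (@ger0_norm _ (t - s)) ?subr_ge0//.
by apply: (norm_MVT_segment st) => u /itvc; [exact: dfE|exact: dfC].
Qed.

End MatrixNorm.

(** * Existence of solutions of differential equations *)

Section Picard.
Context {R : realType}.

Lemma scalar_antiderivative (h : R -> R) : continuous h ->
  exists H : R -> R, forall t : R, `|t| < 1 -> is_derive t 1 H (h t).
Proof.
move=> hc.
exists (fun x => (\int[lebesgue_measure]_(t in [set` `[(-1)%R, x]]) (h t))%R) => t.
rewrite ltr_norml => /andP[t1 t2].
have hi : lebesgue_measure.-integrable `[(-1)%R, 1%R] (EFin \o h).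
  apply: continuous_compact_integrable; first exact: segment_compact.
  exact: continuous_subspaceT.
have [d dE] := continuous_FTC1_closed t2 hi t1 (hc t).
split; first exact: d.
by rewrite -derive1E; exact: dE.
Qed.

Lemma antiderivative {m n : nat} (h : R -> 'M[R]_(m, n)) : continuous h ->
  exists H : R -> 'M[R]_(m, n), H 0 = 0 /\
    forall t : R, `|t| < 1 -> is_derive t 1 H (h t).
Proof.
move=> hc.
have /choice[H HE] : forall ij : 'I_m * 'I_n, exists H : R -> R,
    forall t : R, `|t| < 1 -> is_derive t 1 H (h t ij.1 ij.2).
  move=> [i j]/=; apply: (@scalar_antiderivative (fun t => h t i j)) => t.
  apply: (@continuous_comp _ _ _ h (fun M : 'M[R]_(m, n) => M i j)).
    exact: hc.
  exact: coord_continuous.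
exists (fun t => \matrix_(i, j) (H (i, j) t - H (i, j) 0)); split=> [|t t1].
  by apply/matrixP => i j; rewrite !mxE subrr.
apply/is_derive_mxP => i j.
rewrite (_ : (fun _ => _) = H (i, j) - cst (H (i, j) 0)); last first.
  by apply/funext => x; rewrite mxE.
have := HE (i, j) t t1 => /= d.
by apply: is_derive_eq; rewrite subr0.
Qed.

Definition clip (c t : R) : R := Num.max (- c) (Num.min c t).

Lemma clip_norm (c t : R) : 0 <= c -> `|clip c t| <= c.
Proof.
move=> c0; rewrite ler_norml /clip le_max lexx/= ge_max ge_min lexx/= andbT.
by rewrite (le_trans _ c0)// oppr_le0.
Qed.

Lemma clip_id (c t : R) : `|t| <= c -> clip c t = t.
Proof.
by rewrite ler_norml /clip => /andP[a b]; rewrite (min_idPr b) (max_idPr a).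
Qed.

Lemma clip_lip (c s t : R) : `|clip c s - clip c t| <= `|s - t|.
Proof.
have h1 := ler_norm (s - t); have h2 := ler_norm (t - s).
rewrite distrC in h2; set d := `|s - t| in h1 h2 *.
rewrite ler_norml /clip /Num.max /Num.min.
by do ![case: ifPn]; rewrite -?leNgt => *; apply/andP; split; lra.
Qed.

Lemma clip_continuous (c : R) : continuous (clip c).
Proof.
by apply: (@lip_continuous _ R R _ 1) => x y; rewrite mul1r clip_lip.
Qed.

Lemma lt_half_pow (D e : R) : 0 < e -> exists k, D / 2 ^+ k < e.
Proof.
move=> e0; have D1 : 0 < `|D| + 1 by rewrite ltr_wpDl.
have De : 0 < e / (`|D| + 1) by rewrite divr_gt0.
have [k _ /(_ k (leqnn k))/= kE] := near_infty_natSinv_expn_lt (PosNum De).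
exists k; rewrite (@le_lt_trans _ _ ((`|D| + 1) * (1 / 2 ^+ k)))//.
  rewrite mul1r ler_wpM2r ?invr_ge0 ?exprn_ge0// (le_trans (ler_norm _))//.
  by rewrite lerDl.
by rewrite mulrC -ltr_pdivlMr.
Qed.

Theorem picard {m n : nat} (F : R -> 'M[R]_(m, n) -> 'M[R]_(m, n)) (K M c : R)
    (x0 : 'M[R]_(m, n)) :
  (forall x : R -> 'M[R]_(m, n), continuous x -> continuous (fun t => F t (x t))) ->
  (forall t x y, `|F t x - F t y| <= K * `|x - y|) ->
  (forall t, `|F t x0| <= M) ->
  0 <= K -> 0 < c -> c < 1 -> c * K <= 1 / 2 ->
  exists x : R -> 'M[R]_(m, n), [/\ continuous x, x 0 = x0
    & forall t : R, `|t| < c -> is_derive t 1 x (F t (x t))].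
Proof.
move=> Fc FK FM K0 c0 c1 cK.
pose A (h : R -> 'M[R]_(m, n)) := xget (cst 0) [set H : R -> 'M[R]_(m, n) | H 0 = 0 /\
    forall t : R, `|t| < 1 -> is_derive t 1 H (h t)].
have AE h : continuous h -> A h 0 = 0 /\
    forall t : R, `|t| < 1 -> is_derive t 1 (A h) (h t).
  by move=> /antiderivative; exact: xgetPex.
(* Clipping the time makes every iterate a continuous function on the whole line. *)
pose S x := fun t => x0 + A (fun s => F s (x s)) (clip c t).
have clip1 t : `|clip c t| < 1 by rewrite (le_lt_trans (clip_norm t (ltW c0))).
have n01 : `|0 : R| < 1 by rewrite normr0.
have Sc x : continuous x -> continuous (S x).
  move=> /Fc/AE[_ dA] t; apply: cvgD; first exact: cvg_cst.
  apply: (@continuous_comp _ _ _ (clip c)); first exact: clip_continuous.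
  exact: is_derive_continuous (dA _ (clip1 t)).
have SD x y D : continuous x -> continuous y ->
    (forall t, `|x t - y t| <= D) -> forall t, `|S x t - S y t| <= D / 2.
  move=> /Fc/AE[A0x dAx] /Fc/AE[A0y dAy] xyD t.
  have D0 : 0 <= D by rewrite (le_trans _ (xyD 0)).
  rewrite /S opprD addrACA subrr add0r.
  set H := A _ in A0x dAx *; set G := A _ in A0y dAy *.
  have HG (s : R) : `|s| < 1 -> is_derive s 1 (H - G) (F s (x s) - F s (y s)).
    by move=> s1; have := dAx s s1; have := dAy s s1 => *; exact: is_deriveB.
  have FD (s : R) : `|s| < 1 -> `|F s (x s) - F s (y s)| <= K * D.
    by move=> _; rewrite (le_trans (FK _ _ _))// ler_wpM2l.
  have := norm_MVT HG FD n01 (clip1 t).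
  rewrite /= -[(H - G) 0]/(H 0 - G 0) -[(H - G) _]/(H (clip c t) - G (clip c t)).
  rewrite A0x A0y !subr0 => /le_trans; apply.
  rewrite (@le_trans _ _ (K * D * c)) ?ler_wpM2l ?mulr_ge0 ?clip_norm ?(ltW c0)//.
  by nra.
pose X k := iter k S (cst x0).
have Xc k : continuous (X k) by elim: k => [t|k ih]; [exact: cvg_cst|exact: Sc].
have M0 : 0 <= M by rewrite (le_trans _ (FM 0)).
have X1 t : `|X 1%N t - X 0%N t| <= M.
  rewrite /X /= /S addrC addKr.
  have /Fc/AE[A0 dA] := Xc 0%N; set H := A _ in A0 dA *.
  have := norm_MVT dA (fun t _ => FM t) n01 (clip1 t).
  by rewrite A0 !subr0 => /le_trans; apply; rewrite ler_piMr// ltW.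
have XS k t : `|X k.+1 t - X k t| <= M / 2 ^+ k.
  elim: k t => [|k ih] t; first by rewrite expr0 divr1.
  by rewrite exprSr invfM mulrA; apply: SD ih t.
have XD k j t : `|X (k + j)%N t - X k t| <= 2 * M / 2 ^+ k - 2 * M / 2 ^+ (k + j).
  elim: j => [|j ih]; first by rewrite addn0 !subrr normr0.
  rewrite addnS (le_trans (ler_distD (X (k + j)%N t) _ _))//.
  rewrite (le_trans (lerD (XS _ _) ih))// exprSr.
  have : 2 ^+ (k + j) != 0 :> R by rewrite expf_neq0.
  have : 2 ^+ k != 0 :> R by rewrite expf_neq0.
  move: (2 ^+ (k + j)) (2 ^+ k) => p q q0 p0.
  by rewrite le_eqVlt; apply/orP; left; apply/eqP; field; rewrite q0 p0.
have XB k j t : `|X (k + j)%N t - X k t| <= 2 * M / 2 ^+ k.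
  by rewrite (le_trans (XD k j t))// gerBl !mulr_ge0// invr_ge0 exprn_ge0.
have Xcvg t : cvgn (fun k => X k t).
  apply/cauchy_cvgP/cauchy_exP => e e0.
  have [k kE] := lt_half_pow (2 * M) e0; exists (X k t).
  exists k => // l /= kl; rewrite -ball_normE/= distrC -(subnKC kl).
  exact: le_lt_trans (XB _ _ _) kE.
pose x t := limn (fun k => X k t).
have xX k t : `|x t - X k t| <= 2 * M / 2 ^+ k.
  apply/ler_addgt0Pr => e e0.
  have [N _ /(_ (k + N)%N (leq_addl _ _))/= NE] := cvgr_dist_lt _ _ (Xcvg t) _ e0.
  rewrite (le_trans (ler_distD (X (k + N)%N t) _ _))// addrC lerD//.
  exact: ltW.
have xc : continuous x.
  move=> t; apply/continuous_distP => e e0.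
  have e3 : 0 < e / 3 by rewrite divr_gt0.
  have [k kE] := lt_half_pow (2 * M) e3.
  have /continuous_distP/(_ _ e3)[d d0 dE] := Xc k t.
  exists d => // y ty.
  have := dE y ty; have := xX k t; have := xX k y.
  have := ler_distD (X k t) (x t) (x y); have := ler_distD (X k y) (X k t) (x y).
  rewrite (distrC (X k y) (x y)); lra.
have SxE : x = S x.
  apply/funext => t; apply/eqP; rewrite -subr_eq0 -normr_le0.
  apply/ler_addgt0Pr => e e0; rewrite add0r.
  have e2 : 0 < e / 2 by rewrite divr_gt0.
  have [k kE] := lt_half_pow (2 * M) e2.
  have xX' s : `|X k s - x s| <= 2 * M / 2 ^+ k by rewrite distrC.
  have h2 := SD _ _ _ (Xc k) xc xX' t.
  have := ler_distD (X k.+1 t) (x t) (S x t); rewrite -[X k.+1]/(S (X k)).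
  have := xX k.+1 t; rewrite -[X k.+1]/(S (X k)) exprSr invfM mulrA.
  move: h2 kE; set a := 2 * M / _; lra.
clear xX; clearbody x; exists x; split=> //.
  have /Fc/AE[A0 _] := xc.
  by rewrite SxE /S clip_id ?normr0 ?ltW// A0 addr0.
move=> t tc; have /Fc/AE[_ dA] := xc.
have := dA t (lt_trans tc c1); set H := A _ => dH.
have {}dH : is_derive t 1 (cst x0 + H) (F t (x t)).
  by rewrite -[F t _]add0r; exact: is_deriveD.
apply: near_eq_is_derive dH.
apply/nbhs_distP; exists (c - `|t|) => [|s st]; first by rewrite subr_gt0.
rewrite [in RHS]SxE /S clip_id//.
have := ler_distD 0 s t; have := ler_distD t s 0; rewrite !subr0 distrC.
by move: st => /[swap]; lra.
Qed.

End Picard.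

(** * Local estimates for smooth maps *)

Lemma norm_le_dist {R : numDomainType} {V : normedZmodType R} (a b : V) (e : R) :
  `|a - b| <= e -> `|b| <= `|a| + e.
Proof.
by move=> abe; rewrite -lerBlDl (le_trans (lerB_dist _ _))// distrC.
Qed.

Section LocalEstimates.
Context {R : realType} {n p q : nat}.
Implicit Type f : 'rV[R]_n -> 'M[R]_(p, q).

Lemma smooth_differentiable {V W : normedModType R} (f : V -> W) :
  smooth f -> forall x, differentiable f x.
Proof. by move=> fs; have /=[] := fs 1%N. Qed.

Lemma smooth_derive {V W : normedModType R} (f : V -> W) (v : V) :
  smooth f -> smooth ('D_v f).
Proof. by move=> fs k; have /=[_] := fs k.+1. Qed.

Lemma smooth_continuous {V W : normedModType R} (f : V -> W) :
  smooth f -> continuous f.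
Proof. by move=> fs; exact: (fs 0%N). Qed.

Lemma diff_delta f (x v : 'rV[R]_n) : differentiable f x ->
  'd f x v = \sum_(i < n) v 0 i *: 'D_(delta_mx 0 i) f x.
Proof.
move=> df; rewrite {1}(row_sum_delta v) linear_sum; apply: eq_bigr => i _.
by rewrite linearZ/= deriveE.
Qed.

Lemma diffB_delta f (x y v : 'rV[R]_n) : differentiable f x -> differentiable f y ->
  'd f x v - 'd f y v =
  \sum_(i < n) v 0 i *: ('D_(delta_mx 0 i) f x - 'D_(delta_mx 0 i) f y).
Proof.
move=> /(diff_delta v) ex /(diff_delta v) ey.
transitivity (\sum_(i < n) v 0 i *: 'D_(delta_mx 0 i) f x
            - \sum_(i < n) v 0 i *: 'D_(delta_mx 0 i) f y).
  exact: (f_equal2 (fun a b => a - b) ex ey).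
by rewrite -sumrB; apply: eq_bigr => i _; rewrite scalerBr.
Qed.

Lemma is_derive_scalel {V : normedModType R} (w : V) (t : R) :
  is_derive t 1 (fun s : R => s *: w) w.
Proof.
have [ds dE] := is_diff_scalel t w.
by apply: DeriveDef; [exact/derivable1_diffP|rewrite deriveE// dE scale1r].
Qed.

Lemma diff_segment f (x y : 'rV[R]_n) (w : 'M[R]_(p, q)) (C : R) :
  (forall z, differentiable f z) ->
  (forall t, 0 <= t <= 1 -> `|'d f (y + t *: (x - y)) (x - y) - w| <= C) ->
  `|f x - f y - w| <= C.
Proof.
move=> df fC.
pose h (t : R) := y + t *: (x - y).
have dh (t : R) : is_derive t 1 h (x - y).
  have := is_deriveD (is_derive_cst y t (1 : R)) (is_derive_scalel (x - y) t).
  by rewrite add0r.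
have dfh (t : R) : is_derive t 1 (fun t => f (h t) - t *: w) ('d f (h t) (x - y) - w).
  apply: is_deriveB; first exact: is_derive_diff_comp.
  exact: is_derive_scalel.
have := norm_MVT_segment ler01 (fun t _ => dfh t) fC.
rewrite /h !scale0r !scale1r subr0 addr0 subr0 mulr1 (addrC y) subrK.
by rewrite addrAC.
Qed.


Lemma segment_ball (c x y : 'rV[R]_n) (r t : R) : `|x - c| <= r -> `|y - c| <= r ->
  0 <= t <= 1 -> `|y + t *: (x - y) - c| <= r.
Proof.
move=> xr yr /andP[t0 t1].
have -> : y + t *: (x - y) - c = t *: (x - c) + (1 - t) *: (y - c).
  by apply/matrixP => i j; rewrite !mxE; ring.
rewrite (le_trans (ler_normD _ _))// !normrZ (ger0_norm t0) ger0_norm ?subr_ge0//.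
by nra.
Qed.

Lemma diff_bounded f (c : 'rV[R]_n) :
  (forall x, differentiable f x) -> (forall v, continuous ('D_v f)) ->
  exists r K : R, [/\ 0 < r, 0 <= K &
    forall x v, `|x - c| <= r -> `|'d f x v| <= K * `|v|].
Proof.
move=> df dfc.
pose K := \sum_(i < n) (`|'D_(delta_mx 0 i) f c| + 1).
have : \forall x \near c, forall i : 'I_n,
    `|'D_(delta_mx 0 i) f x| <= `|'D_(delta_mx 0 i) f c| + 1.
  apply: (@filter_forall _ 'I_n _ (nbhs c) _) => i.
  have /continuous_distP/(_ _ ltr01)[d d0 dE] := dfc (delta_mx 0 i) c.
  apply/nbhs_distP; by exists d => // y /dE/ltW /norm_le_dist.
move=> /nbhs_distP[r r0 rE]; exists (r / 2), K; split.
- by rewrite divr_gt0.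
- by rewrite sumr_ge0// => i _; rewrite addr_ge0.
move=> x v xr; rewrite diff_delta// (le_trans (ler_norm_sum _ _ _))//.
rewrite mulr_suml ler_sum// => i _; rewrite normrZ mulrC ler_pM//.
  by apply: rE; rewrite distrC (le_lt_trans xr)// ltr_pdivrMr// ltr_pMr// ltr1n.
exact: mx_coord_le.
Qed.

Lemma diff_local_lip f (c : 'rV[R]_n) :
  (forall x, differentiable f x) -> (forall v, continuous ('D_v f)) ->
  exists r K : R, [/\ 0 < r, 0 <= K & forall x y, `|x - c| <= r -> `|y - c| <= r ->
    `|f x - f y| <= K * `|x - y|].
Proof.
move=> df /(diff_bounded c df)[r [K [r0 K0 rK]]].
exists r, K; split=> // x y xr yr.
rewrite -[f x - f y]subr0; apply: diff_segment => // t t01.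
by rewrite subr0; apply: rK; exact: segment_ball.
Qed.

Lemma smooth_local_estimates f (c : 'rV[R]_n) : smooth f ->
  exists r K : R, [/\ 0 < r, 0 <= K & forall x y z eta,
    `|x - c| <= r -> `|y - c| <= r -> `|z - c| <= r ->
    [/\ `|f x| <= K, `|f x - f y| <= K * `|x - y|,
      (forall v, `|'d f x v| <= K * `|v|),
      (forall v, `|'d f x v - 'd f y v| <= K * `|v| * `|x - y|)
    & (`|x - z| <= eta -> `|y - z| <= eta ->
      `|f x - f y - 'd f z (x - y)| <= K * eta * `|x - y|)]].
Proof.
move=> fs.
have df := smooth_differentiable fs.
have dfs v := smooth_derive v fs.
have dfc v := smooth_continuous (dfs v).
have [r1 [K1 [r10 K10 E1]]] := diff_bounded c df dfc.
have [r2 [K2 [r20 K20 E2]]] := diff_local_lip c df dfc.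
have /choice[rho rhoE] i : exists rK : R * R, [/\ 0 < rK.1, 0 <= rK.2 &
    forall x y, `|x - c| <= rK.1 -> `|y - c| <= rK.1 ->
    `|'D_(delta_mx 0 i) f x - 'D_(delta_mx 0 i) f y| <= rK.2 * `|x - y|].
  have [r [K h]] := diff_local_lip c (smooth_differentiable (dfs (delta_mx 0 i)))
    (fun v => smooth_continuous (smooth_derive v (dfs (delta_mx 0 i)))).
  by exists (r, K).
pose r3 := \big[Num.min/1]_(i < n) (rho i).1.
pose K3 := \sum_(i < n) (rho i).2.
have r30 : 0 < r3 by rewrite lt_bigmin ?ltr01//= => i _; have [] := rhoE i.
have K30 : 0 <= K3 by rewrite sumr_ge0// => i _; have [] := rhoE i.
have E3 x y v : `|x - c| <= r3 -> `|y - c| <= r3 ->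
    `|'d f x v - 'd f y v| <= K3 * `|v| * `|x - y|.
  move=> xr yr; rewrite diffB_delta//.
  rewrite (le_trans (ler_norm_sum _ _ _))//.
  rewrite !mulr_suml ler_sum// => i _; have [_ Ki h] := rhoE i.
  have ri : r3 <= (rho i).1 by exact: bigmin_le_cond.
  rewrite normrZ mulrAC [leRHS]mulrC ler_pM ?mx_coord_le//.
  by apply: h; [exact: le_trans xr ri|exact: le_trans yr ri].
pose r := Num.min r1 (Num.min r2 r3).
pose K := K1 + K2 + K3 + `|f c| + K2 * r.
have rr : [/\ r <= r1, r <= r2 & r <= r3] by rewrite /r !ge_min !lexx !orbT.
have r0 : 0 < r by rewrite /r !lt_min r10 r20 r30.
have K2r : 0 <= K2 * r by rewrite mulr_ge0// ltW.
have fc0 := normr_ge0 (f c).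
have KK : [/\ 0 <= K, K1 <= K, K2 <= K & K3 <= K] by rewrite /K; split; lra.
exists r, K; case: KK rr => K0 K1K K2K K3K [rr1 rr2 rr3]; split=> // x y z eta xr yr zr.
have cc : `|c - c| <= r2 by rewrite subrr normr0 ltW.
split.
- have := E2 x c (le_trans xr rr2) cc; have := ler_distD 0 (f x) (f c).
  have := ler_wpM2l K20 xr.
  have := ler_distD (f c) (f x) 0; rewrite !subr0 sub0r normrN => *.
  by rewrite /K; lra.
- rewrite (le_trans (E2 _ _ (le_trans xr rr2) (le_trans yr rr2)))//.
  by rewrite ler_wpM2r.
- by move=> v; rewrite (le_trans (E1 _ _ (le_trans xr rr1)))// ler_wpM2r.
- move=> v; rewrite (le_trans (E3 _ _ _ (le_trans xr rr3) (le_trans yr rr3)))//.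
  by rewrite !ler_wpM2r.
move=> xz yz; apply: diff_segment => // t t01.
have tr : `|y + t *: (x - y) - c| <= r by exact: segment_ball.
rewrite (le_trans (E3 _ _ _ (le_trans tr rr3) (le_trans zr rr3)))//.
rewrite -!mulrA ler_pM// [leRHS]mulrC ler_wpM2l//.
by apply: segment_ball t01.
Qed.

End LocalEstimates.

(** * Flows *)

Section Flow.
Context {R : realType}.

Lemma short_gronwall {m n : nat} (w dw : R -> 'M[R]_(m, n)) (c K eta : R) :
  0 <= K -> 0 <= eta -> 0 < c -> c * K <= 1 / 2 -> continuous w ->
  (forall t : R, `|t| < c -> is_derive t 1 w (dw t)) ->
  (forall t, `|t| < c -> `|dw t| <= K * `|w t| + eta) ->
  forall t, `|t| < c -> `|w t| <= 2 * (`|w 0| + c * eta).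
Proof.
move=> K0 eta0 c0 cK wc dwE dwK.
pose A : set R := [set `|w t| | t in [set t | `|t| < c]].
have n0 : `|0 : R| < c by rewrite normr0.
have supA : has_sup A.
  split; first by exists `|w 0|, 0.
  have nc : {within `[- c, c], continuous (fun t => `|w t|)}.
    apply: continuous_subspaceT => t.
    by apply: (@continuous_comp _ _ _ w Num.norm); [exact: wc|exact: norm_continuous].
  have cc : - c <= c by lra.
  have [s _ sE] := EVT_max cc nc.
  exists `|w s| => _ [t /= tc <-]; apply: sE.
  by rewrite in_itv/= -ler_norml ltW.
have S0 : 0 <= sup A by
  rewrite (le_trans (normr_ge0 (w 0)))// ub_le_sup//; [exact: supA.2|exists 0].
have wS t : `|t| < c -> `|w t| <= sup A.
  by move=> tc; rewrite ub_le_sup//; [exact: supA.2|exists t].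
have wB t : `|t| < c -> `|w t| <= `|w 0| + (sup A / 2 + c * eta).
  move=> tc.
  have dwB s : `|s| < c -> `|dw s| <= K * sup A + eta.
    by move=> sc; rewrite (le_trans (dwK _ sc))// lerD2r ler_wpM2l// wS.
  have := norm_MVT dwE dwB n0 tc; rewrite subr0 => h.
  have -> : w t = w 0 + (w t - w 0) by rewrite addrC subrK.
  rewrite (le_trans (ler_normD _ _))// lerD2l (le_trans h)//.
  apply: (@le_trans _ _ ((K * sup A + eta) * c)).
    by rewrite ler_wpM2l ?addr_ge0 ?mulr_ge0// ltW.
  by nra.
have : sup A <= `|w 0| + (sup A / 2 + c * eta).
  by apply: ge_sup; [exact: supA.1|move=> _ [t /= tc <-]; exact: wB].
move: (sup A) (`|w 0|) wS => S w0 wS SE t /wS; lra.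
Qed.

Lemma small_time (a b : R) : 0 <= a -> 0 <= b ->
  exists c : R, [/\ 0 < c, c < 1, c * a <= 1 / 2 & c * b <= 1 / 2].
Proof.
move=> a0 b0; exists (2 + 2 * a + 2 * b)^-1.
have d0 : 0 < 2 + 2 * a + 2 * b by lra.
by split; rewrite ?invr_gt0// ?invf_lt1//; try lra;
  rewrite mulrC ler_pdivrMr//; lra.
Qed.

Lemma mulmx_continuous {m n p : nat} (A : R -> 'M[R]_(m, n)) (B : R -> 'M[R]_(n, p)) :
  continuous A -> continuous B -> continuous (fun t => A t *m B t).
Proof.
move=> Ac Bc t; apply: cvg_mxP => i j.
rewrite (_ : (fun x => (A x *m B x) i j) =
    fun x => \sum_(k < n) A x i k * B x k j); last first.
  by apply/funext => x; rewrite mxE.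
rewrite mxE; apply: cvg_big => [|k _]; [exact: add_continuous|apply: cvgM].
  by apply: (@continuous_comp _ _ _ A (fun M : 'M[R]_(m, n) => M i k));
    [exact: Ac|exact: coord_continuous].
by apply: (@continuous_comp _ _ _ B (fun M : 'M[R]_(n, p) => M k j));
  [exact: Bc|exact: coord_continuous].
Qed.

Definition clip_ball {n : nat} (c : 'rV[R]_n) (r : R) (x : 'rV[R]_n) : 'rV[R]_n :=
  \row_j (c 0 j + clip r (x 0 j - c 0 j)).

Lemma clip_ball_norm {n : nat} (c : 'rV[R]_n) (r : R) x : 0 <= r ->
  `|clip_ball c r x - c| <= r.
Proof.
by move=> r0; apply: mx_norm_leP => // i j; rewrite !mxE !ord1 addrC addKr clip_norm.
Qed.

Lemma clip_ball_id {n : nat} (c : 'rV[R]_n) (r : R) x : `|x - c| <= r ->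
  clip_ball c r x = x.
Proof.
move=> xr; apply/rowP => j; rewrite mxE clip_id ?(addrC (c 0 j)) ?subrK//.
by have := mx_coord_le (x - c) 0 j; rewrite !mxE => /le_trans; apply.
Qed.

Lemma clip_ball_lip {n : nat} (c : 'rV[R]_n) (r : R) x y :
  `|clip_ball c r x - clip_ball c r y| <= `|x - y|.
Proof.
apply: mx_norm_leP => // i j; rewrite !mxE opprD addrACA subrr add0r.
rewrite (le_trans (clip_lip _ _ _))// opprD addrACA opprK addNr addr0.
by have := mx_coord_le (x - y) 0 j; rewrite !mxE.
Qed.

End Flow.

Section FlowTheorem.
Context {R : realType} {n : nat}.
Implicit Types (X : 'rV[R]_n -> 'rV[R]_n) (p x y : 'rV[R]_n).

(* In row vector convention [V t] is the derivative of [phi t] at [p] and [W t] its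
   inverse. *)
Record local_flow X p (N : set 'rV[R]_n) (c : R) (phi : R -> 'rV[R]_n -> 'rV[R]_n)
    (V W : R -> 'M[R]_n) : Prop := LocalFlow {
  flow_init : forall x, phi 0 x = x;
  flow_derive : forall x (t : R), `|x - p| < c -> `|t| < c ->
    is_derive t 1 (phi^~ x) (X (phi t x)) /\ N (phi t x);
  flow_lip : exists K, forall x (s t : R), `|s| < c -> `|t| < c ->
    `|phi t x - phi s x| <= K * `|t - s|;
  flow_inv : forall t, `|t| < c -> V t *m W t = 1%:M;
  flow_inv0 : W 0 = 1%:M;
  flow_inv_derive : is_derive (0 : R) 1 W (- jacobian X p);
  flow_strict : forall s e, `|s| < c -> 0 < e -> exists2 d : R, 0 < d &
    forall x y t t', `|x - p| < d -> `|y - p| < d -> `|t - s| < d -> `|t' - s| < d ->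
    `|phi t x - phi t' y - (t - t') *: X (phi s p) - (x - y) *m V s| <=
      e * (`|t - t'| + `|x - y|)
}.

Lemma jacobian_continuous_on X p (r K : R) : 0 <= K ->
  (forall x y v, `|x - p| <= r -> `|y - p| <= r ->
    `|'d X x v - 'd X y v| <= K * `|v| * `|x - y|) ->
  forall x y, `|x - p| <= r -> `|y - p| <= r ->
    `|jacobian X x - jacobian X y| <= K * `|x - y|.
Proof.
move=> K0 h x y xr yr; apply: mx_norm_leP => [|i j]; first by rewrite mulr_ge0.
have := mx_coord_le ('d X x (delta_mx 0 i) - 'd X y (delta_mx 0 i)) 0 j.
rewrite !mxE => /le_trans; apply.
rewrite (le_trans (h _ _ _ xr yr))// -mulrA ler_wpM2l// ler_piMl//.
apply: mx_norm_leP => // k l; rewrite mxE.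
by case: (_ && _); rewrite ?normr0 ?normr1.
Qed.

Lemma jacobian_norm_le X x (K : R) : 0 <= K ->
  (forall v, `|'d X x v| <= K * `|v|) -> `|jacobian X x| <= K.
Proof.
move=> K0 h; apply: mx_norm_leP => // i j.
have := mx_coord_le ('d X x (delta_mx 0 i)) 0 j.
rewrite !mxE => /le_trans; apply; rewrite (le_trans (h _))// ler_piMr//.
apply: mx_norm_leP => // k l; rewrite mxE.
by case: (_ && _); rewrite ?normr0 ?normr1.
Qed.

Lemma diff_jacobian X x v : 'd X x v = v *m jacobian X x.
Proof. by rewrite /jacobian mul_rV_lin1. Qed.


Theorem exists_local_flow X p (N : set 'rV[R]_n) : smooth X -> nbhs p N ->
  exists c phi V W, 0 < c /\ local_flow X p N c phi V W.
Proof.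
move=> Xs /nbhs_distP[rN rN0 NE].
have dX := smooth_differentiable Xs.
have [r0 [K [r00 K0 XK0]]] := smooth_local_estimates p Xs.
pose r := Num.min r0 (rN / 2).
have r_gt0 : 0 < r by rewrite /r lt_min r00 divr_gt0.
have rr0 : r <= r0 by rewrite /r ge_min lexx.
have rrN : r < rN by rewrite /r gt_min; apply/orP; right; lra.
have XN x : `|x - p| <= r -> N x.
  by move=> xr; apply: NE; rewrite distrC (le_lt_trans xr).
have {XK0} XK x y z eta xr yr zr :=
  XK0 x y z eta (le_trans xr rr0) (le_trans yr rr0) (le_trans zr rr0).
have pr : `|p - p| <= r by rewrite subrr normr0 ltW.
have X_le x (xr : `|x - p| <= r) : `|X x| <= K by have [] := XK x x x 0 xr xr xr.
have X_lip x y (xr : `|x - p| <= r) (yr : `|y - p| <= r) :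
    `|X x - X y| <= K * `|x - y| by have [] := XK x y x 0 xr yr xr.
have dX_le x (xr : `|x - p| <= r) v : `|'d X x v| <= K * `|v|.
  by have [_ _ h _ _] := XK x x x 0 xr xr xr; exact: h.
have dX_lip x y v (xr : `|x - p| <= r) (yr : `|y - p| <= r) :
    `|'d X x v - 'd X y v| <= K * `|v| * `|x - y|.
  by have [_ _ _ h _] := XK x y x 0 xr yr xr; exact: h.
have X_strict x y z eta (xr : `|x - p| <= r) (yr : `|y - p| <= r) (zr : `|z - p| <= r) :
    `|x - z| <= eta -> `|y - z| <= eta ->
    `|X x - X y - 'd X z (x - y)| <= K * eta * `|x - y|.
  by have [_ _ _ _ h] := XK x y z eta xr yr zr; exact: h.
(* Retracting the state to a ball turns [X] into a bounded Lipschitz field, with the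
   same trajectories as long as they stay in the ball. *)
pose rho := clip_ball p r.
have rhor x : `|rho x - p| <= r by apply: clip_ball_norm; exact: ltW.
pose F := X \o rho.
have F_lip x y : `|F x - F y| <= K * `|x - y|.
  rewrite (le_trans (X_lip _ _ (rhor x) (rhor y)))// ler_wpM2l//.
  exact: clip_ball_lip.
have F_le x : `|F x| <= K by exact: X_le.
pose K' := n%:R * K + K.
have nK0 : 0 <= n%:R * K by rewrite mulr_ge0.
have K'0 : 0 <= K' by rewrite addr_ge0.
have [c0 [c00 c01 cK' cKr]] : exists c : R, [/\ 0 < c, c < 1, c * K' <= 1 / 2 &
    c * (2 * K / r) <= 1 / 2].
  by apply: small_time => //; rewrite !mulr_ge0// invr_ge0 ltW.
have {}cKr : c0 * K <= r / 4.
  move: cKr; rewrite !mulrA ler_pdivrMr// => h.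
  by rewrite -(ler_pM2r (x := 2))//; lra.
have cK : c0 * K <= 1 / 2.
  by rewrite (le_trans _ cK')// ler_wpM2l ?(ltW c00)// /K' lerDr.
have cnK : c0 * (n%:R * K) <= 1 / 2.
  by rewrite (le_trans _ cK')// ler_wpM2l ?(ltW c00)// /K' lerDl.
have /choice[Phi PhiE] x : exists f : R -> 'rV[R]_n, [/\ continuous f, f 0 = x
    & forall t : R, `|t| < c0 -> is_derive t 1 f (F (f t))].
  apply: (@picard _ _ _ (fun _ => F) K K) => //.
  move=> f fc t; apply: (@continuous_comp _ _ _ f F); first exact: fc.
  exact: (@lip_continuous _ _ _ _ K).
have Phi0 x : Phi x 0 = x by have [] := PhiE x.
have Phic x : continuous (Phi x) by have [] := PhiE x.
have dPhi x (t : R) : `|t| < c0 -> is_derive t 1 (Phi x) (F (Phi x t)).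
  by have [_ _] := PhiE x; exact.
have Phi_lip x s t : `|s| < c0 -> `|t| < c0 -> `|Phi x t - Phi x s| <= K * `|t - s|.
  by move=> sc tc; apply: (norm_MVT (@dPhi x)) => // u _; exact: F_le.
have n0 : `|0 : R| < c0 by rewrite normr0.
have Phi_in x t : `|x - p| < r / 4 -> `|t| < c0 -> `|Phi x t - p| <= r / 2.
  move=> xr tc; have := Phi_lip x 0 t n0 tc; rewrite Phi0 subr0.
  have tK : K * `|t| <= r / 4.
    by rewrite (le_trans _ cKr)// mulrC ler_wpM2r// ltW.
  have := ler_distD x (Phi x t) p.
  move: (`|_ - p|) (`|_ - p|) (`|_ - x|) xr tK => a b d; lra.
have Phi_inr x t (xr : `|x - p| < r / 4) (tc : `|t| < c0) : `|Phi x t - p| <= r.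
  by rewrite (le_trans (Phi_in _ _ xr tc))//; lra.
have FE x t : `|x - p| < r / 4 -> `|t| < c0 -> F (Phi x t) = X (Phi x t).
  by move=> xr tc; rewrite /F /= /rho clip_ball_id// Phi_inr.
have pr4 : `|p - p| < r / 4 by rewrite subrr normr0 divr_gt0.
have Phi_diff x y t : `|t| < c0 -> `|Phi x t - Phi y t| <= 2 * `|x - y|.
  move=> tc.
  have := @short_gronwall _ _ _ (Phi x - Phi y)
    (fun t => F (Phi x t) - F (Phi y t)) c0 K 0 K0 (lexx _) c00 cK.
  rewrite mulr0 -[(Phi x - Phi y) 0]/(Phi x 0 - Phi y 0) !Phi0 addr0.
  apply => //.
  - by move=> s; apply: continuousB; exact: Phic.
  - by move=> s sc; apply: is_deriveB; exact: dPhi.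
  - by move=> s sc; rewrite addr0; exact: F_lip.
pose A t := jacobian X (rho (Phi p t)).
have AE t : `|t| < c0 -> A t = jacobian X (Phi p t).
  by move=> tc; rewrite /A /rho clip_ball_id// Phi_inr.
have A_le t : `|A t| <= K by apply: jacobian_norm_le => // v; exact: dX_le.
have Ac : continuous A.
  move=> t; apply: (@continuous_comp _ _ _ (Phi p) (jacobian X \o rho)).
    exact: Phic.
  apply: (@lip_continuous _ _ _ _ K) => x y /=.
  have h := jacobian_continuous_on K0 dX_lip (rhor x) (rhor y).
  rewrite (le_trans h)//.
  by rewrite ler_wpM2l// clip_ball_lip.
have mulA_le m1 m2 (B : 'M[R]_(m1, n)) (C : 'M[R]_(n, m2)) t :
    `|B *m A t| <= n%:R * K * `|B| /\ `|A t *m C| <= n%:R * K * `|C|.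
  split; rewrite (le_trans (mulmx_norm_le _ _))// -!mulrA ler_wpM2l//.
    by rewrite mulrC ler_wpM2r.
  by rewrite ler_wpM2r.
have [V [Vc V0 dV]] : exists V : R -> 'M[R]_n, [/\ continuous V, V 0 = 1%:M
    & forall t : R, `|t| < c0 -> is_derive t 1 V (V t *m A t)].
  apply: (@picard _ _ _ (fun t B => B *m A t) (n%:R * K)
    (n%:R * K * `|1%:M : 'M[R]_n|) c0 _ _ _ _ nK0 c00 c01 cnK).
  - by move=> f fc; exact: mulmx_continuous.
  - by move=> t B C; rewrite -mulmxBl; have [] := mulA_le _ n (B - C) 0 t.
  - by move=> t; have [] := mulA_le _ n (1%:M : 'M[R]_n) 0 t.
have [W [Wc W0 dW]] : exists W : R -> 'M[R]_n, [/\ continuous W, W 0 = 1%:M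
    & forall t : R, `|t| < c0 -> is_derive t 1 W (- (A t *m W t))].
  apply: (@picard _ _ _ (fun t B => - (A t *m B)) (n%:R * K)
    (n%:R * K * `|1%:M : 'M[R]_n|) c0 _ _ _ _ nK0 c00 c01 cnK).
  - by move=> f fc t; apply: cvgN; exact: (mulmx_continuous Ac fc).
  - move=> t B C; rewrite -opprD normrN -mulmxBr.
    by have [] := mulA_le n _ 0 (B - C) t.
  - by move=> t; rewrite normrN; have [] := mulA_le n _ 0 (1%:M : 'M[R]_n) t.
have VW t : `|t| < c0 -> V t *m W t = 1%:M.
  move=> tc.
  have dVW (s : R) : `|s| < c0 -> is_derive s 1 (fun s => V s *m W s) 0.
    move=> sc; have := is_derive_mulmx (dV s sc) (dW s sc).
    by rewrite mulmxN mulmxA subrr.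
  have dVW0 : `|0 : 'M[R]_n| <= 0 by rewrite normr0.
  have := norm_MVT dVW (fun t _ => dVW0) n0 tc.
  by rewrite mul0r normr_le0 subr_eq0 V0 W0 mulmx1 => /eqP.
(* [V] solves the variational equation along [Phi p], which the difference of two
   trajectories satisfies up to a quadratic error. *)
have V_strict eta x y t : `|x - p| < r / 4 -> `|y - p| < r / 4 -> `|t| < c0 ->
    `|x - p| <= eta -> `|y - p| <= eta ->
    `|Phi x t - Phi y t - (x - y) *m V t| <= 8 * K * eta * `|x - y|.
  move=> xr yr tc xe ye.
  have eta0 : 0 <= eta by rewrite (le_trans _ xe).
  pose w s := Phi x s - Phi y s - (x - y) *m V s.
  pose dw s := F (Phi x s) - F (Phi y s) - (x - y) *m (V s *m A s).
  have dwE (s : R) : `|s| < c0 -> is_derive s 1 w (dw s).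
    move=> sc; apply: is_deriveB; first by apply: is_deriveB; exact: dPhi.
    have := is_derive_mulmx (is_derive_cst (x - y) s (1 : R)) (dV s sc).
    by rewrite mul0mx add0r.
  have wc : continuous w.
    move=> s; apply: cvgB; first by apply: cvgB; exact: Phic.
    by apply: (mulmx_continuous _ Vc) => u; exact: cvg_cst.
  pose h := 4 * K * eta * `|x - y|.
  have h0 : 0 <= h by rewrite /h !mulr_ge0.
  have dwK s : `|s| < c0 -> `|dw s| <= K * `|w s| + h.
    move=> sc.
    have -> : dw s = 'd X (Phi p s) (w s) +
        (X (Phi x s) - X (Phi y s) - 'd X (Phi p s) (Phi x s - Phi y s)).
      have wJ J : w s *m J = (Phi x s - Phi y s) *m J - (x - y) *m (V s *m J).
        by rewrite /w mulmxBl mulmxA.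
      rewrite /dw !FE// AE// !diff_jacobian wJ.
      by rewrite [RHS]addrC [RHS]addrA addrNK.
    rewrite (le_trans (ler_normD _ _))// lerD//.
      by apply: dX_le; exact: Phi_inr.
    have Phip z : `|z - p| <= eta -> `|Phi z s - Phi p s| <= 2 * eta.
      by move=> ze; rewrite (le_trans (Phi_diff _ _ _ sc))// ler_wpM2l.
    rewrite (le_trans (X_strict _ _ _ _ _ _ _ (Phip _ xe) (Phip _ ye))) ?Phi_inr//.
    rewrite (le_trans (ler_wpM2l _ (Phi_diff x y s sc))) ?mulr_ge0//.
    rewrite /h le_eqVlt; apply/orP; left; apply/eqP; ring.
  have := short_gronwall K0 h0 c00 cK wc dwE dwK tc.
  rewrite {2}/w !Phi0 V0 mulmx1 subrr normr0 add0r => /le_trans; apply.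
  have -> : 8 * K * eta * `|x - y| = 2 * h by rewrite /h; ring.
  by rewrite ler_wpM2l// ler_piMl// ltW.
pose c := Num.min c0 (r / 4).
have cc0 (t : R) : `|t| < c -> `|t| < c0 by rewrite /c lt_min => /andP[].
have cr4 t : t < c -> t < r / 4 by rewrite /c lt_min => /andP[].
exists c, (fun t x => Phi x t), V, W; split.
  by rewrite /c lt_min c00 divr_gt0.
split.
- exact: Phi0.
- move=> x t /cr4 xr /cc0 tc; split; last by apply: XN; exact: Phi_inr.
  by rewrite -FE//; exact: dPhi.
- by exists K => x s t /cc0 sc /cc0 tc; exact: Phi_lip.
- by move=> t /cc0; exact: VW.
- exact: W0.
- have A0 : A 0 = jacobian X p by rewrite (AE _ n0) Phi0.
  have AW0 : A 0 *m W 0 = jacobian X p by rewrite W0 mulmx1.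
  by rewrite -AW0; exact: (dW 0 n0).
move=> s e sc e0.
have eV : 0 < e / (2 * (n%:R + 1)) by rewrite divr_gt0// mulr_gt0// ltr_wpDl.
have /continuous_distP/(_ _ eV)[dV0 dV00 dVE] := Vc s.
pose B := K * K + 10 * K + 1.
have B0 : 0 < B by rewrite /B; clear -K0; nra.
have [d [d0 dc dr dB dd]] : exists d : R,
    [/\ 0 < d, d <= c - `|s|, d <= r / 4, B * d <= e / 2 & d <= dV0].
  exists (Num.min (Num.min (c - `|s|) (r / 4)) (Num.min (e / (2 * B)) dV0)).
  split; last by rewrite !ge_min lexx !orbT.
  - by rewrite !lt_min subr_gt0 sc dV00 !divr_gt0// mulr_gt0.
  - by rewrite !ge_min lexx.
  - by rewrite !ge_min lexx !orbT.
  - have -> : e / 2 = B * (e / (2 * B)) by field; rewrite gt_eqF.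
    by rewrite ler_wpM2l ?(ltW B0)// !ge_min lexx !orbT.
exists d => // x y t t' xd yd td t'd.
have tc (u : R) : `|u - s| < d -> `|u| < c.
  by move=> us; have := ler_distD s u 0; rewrite !subr0; clear -us dc; lra.
have [tc0 t'c0] : `|t| < c0 /\ `|t'| < c0 by split; apply/cc0/tc.
have xr := lt_le_trans xd dr; have yr := lt_le_trans yd dr.
have -> : Phi x t - Phi y t' - (t - t') *: X (Phi p s) - (x - y) *m V s =
  (Phi x t - Phi x t' - (t - t') *: X (Phi p s)) +
  (Phi x t' - Phi y t' - (x - y) *m V t') + (x - y) *m (V t' - V s).
  rewrite mulmxBr; set a := Phi x t; set b := Phi x t'; set f := Phi y t'.
  set g := _ *: _; set h := _ *m V t'; set k := _ *m V s.
  by apply/matrixP => i j; rewrite !mxE; ring.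
have time_part : `|Phi x t - Phi x t' - (t - t') *: X (Phi p s)| <= e / 2 * `|t - t'|.
  wlog tt : t t' td t'd tc0 t'c0 / t' <= t.
    move=> h; have /orP[] := le_total t' t => ?; first exact: h.
    have := h _ _ t'd td t'c0 tc0; rewrite -(opprB t t') scaleNr opprK normrN.
    have -> : Phi x t' - Phi x t + (t - t') *: X (Phi p s) =
       - (Phi x t - Phi x t' - (t - t') *: X (Phi p s)) by rewrite !opprB [RHS]addrC.
    by rewrite normrN; apply.
  pose f u := Phi x u - u *: X (Phi p s).
  have uu u : t' <= u <= t -> `|u - s| < d.
    move=> /andP[u1 u2]; move: td t'd; rewrite !ltr_norml => /andP[_ a2] /andP[b1 _].
    by clear -a2 b1 u1 u2; apply/andP; split; lra.
  have dfE (u : R) : t' <= u <= t -> is_derive u 1 f (F (Phi x u) - X (Phi p s)).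
    move=> /uu/tc/cc0 uc; apply: is_deriveB; first exact: dPhi.
    exact: is_derive_scalel.
  have dfC u : t' <= u <= t -> `|F (Phi x u) - X (Phi p s)| <= e / 2.
    move=> /uu ud; have uc := cc0 _ (tc _ ud).
    rewrite -[X (Phi p s)]FE ?(cc0 _ sc)// (le_trans (F_lip _ _))//.
    have h1 := Phi_diff x p u uc.
    have h2 := Phi_lip p s u (cc0 _ sc) uc.
    have h3 := ler_distD (Phi p u) (Phi x u) (Phi p s).
    have h4 : `|Phi x u - Phi p s| <= (2 + K) * d.
      rewrite (le_trans h3)// mulrDl lerD//.
        by rewrite (le_trans h1)// ler_wpM2l// ltW.
      by rewrite (le_trans h2)// ler_wpM2l// ltW.
    rewrite (le_trans (ler_wpM2l K0 h4))// (le_trans _ dB)// mulrA.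
    by rewrite ler_wpM2r ?(ltW d0)// /B; clear -K0; nra.
  have := norm_MVT_segment tt dfE dfC.
  rewrite (ger0_norm (_ : 0 <= t - t')) ?subr_ge0// /f => h.
  rewrite (le_trans _ h)// le_eqVlt; apply/orP; left; apply/eqP; congr (`|_|).
  by apply/matrixP => i j; rewrite !mxE; ring.
have space_part : `|Phi x t' - Phi y t' - (x - y) *m V t'| <= e / 2 * `|x - y|.
  rewrite (le_trans (V_strict _ _ _ _ xr yr t'c0 (ltW xd) (ltW yd)))//.
  rewrite ler_wpM2r// (le_trans _ dB)// ler_wpM2r ?(ltW d0)// /B; clear -K0; nra.
have V_part : `|(x - y) *m (V t' - V s)| <= e / 2 * `|x - y|.
  have t'dV : `|s - t'| < dV0 by rewrite distrC (lt_le_trans t'd).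
  have := ltW (dVE _ t'dV); rewrite distrC => h.
  rewrite (le_trans (mulmx_norm_le _ _))// mulrAC ler_wpM2r//.
  rewrite (le_trans (ler_wpM2l _ h))//.
  have n1 : 0 < n%:R + 1 :> R by rewrite ltr_wpDl.
  have -> : n%:R * (e / (2 * (n%:R + 1))) = e / 2 * (n%:R / (n%:R + 1)).
    by field; rewrite gt_eqF.
  rewrite ler_piMr ?divr_ge0 ?(ltW e0)// ler_pdivrMr// mul1r.
  by rewrite lerDl.
rewrite (le_trans (ler_normD _ _))// (le_trans (lerD (ler_normD _ _) (lexx _)))//.
rewrite (le_trans (lerD (lerD time_part space_part) V_part))//.
rewrite -addrA -mulrDl -splitr [leRHS]mulrDr lerD2r ler_wpM2r//.
by clear -e0; lra.
Qed.

End FlowTheorem.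

(** * Strict differentiability *)

(* Banach's fixed point theorem is stated for complete normed modules. *)
HB.instance Definition _ (R : realType) m n := Complete.on 'M[R]_(m, n).

Section StrictDiff.
Context {R : realType}.

Definition strict_diff {k n : nat} (G : 'rV[R]_k -> 'rV[R]_n) (p : 'rV[R]_k)
    (L : 'M[R]_(k, n)) : Prop :=
  forall e : R, 0 < e -> exists2 d : R, 0 < d & forall a b,
    `|a - p| < d -> `|b - p| < d -> `|G a - G b - (a - b) *m L| <= e * `|a - b|.

Lemma strict_diff_lip {k n : nat} (G : 'rV[R]_k -> 'rV[R]_n) p L :
  strict_diff G p L -> exists K d : R, [/\ 0 <= K, 0 < d & forall a b,
    `|a - p| < d -> `|b - p| < d -> `|G a - G b| <= K * `|a - b|].
Proof.
move=> /(_ _ ltr01)[d d0 dE]; exists (k%:R * `|L| + 1), d; split=> //.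
move=> a b ad bd; rewrite -(subrK ((a - b) *m L) (G a - G b)).
rewrite (le_trans (ler_normD _ _))// addrC mulrDl lerD ?dE//.
by rewrite (le_trans (mulmx_norm_le _ _))// mulrAC.
Qed.

Lemma strict_diff_interior {n : nat} (G : 'rV[R]_n -> 'rV[R]_n) p L
    (P : set 'rV[R]_n) (d0 : R) :
  L \in unitmx -> strict_diff G p L -> 0 < d0 ->
  (forall a, `|a - p| < d0 -> P (G a)) -> P° !=set0.
Proof.
move=> uL GL d00 GP.
pose M := n%:R * `|invmx L| + 1.
have M0 : 0 < M by rewrite /M ltr_wpDl// mulr_ge0.
have mulL (u : 'rV[R]_n) : `|u *m invmx L| <= M * `|u|.
  rewrite (le_trans (mulmx_norm_le _ _))// mulrAC ler_wpM2r//.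
  by rewrite /M lerDl ler01.
have e0 : 0 < 1 / 2 / M by rewrite !divr_gt0.
have [d1 d10 d1E] := GL _ e0.
pose d := Num.min d0 d1 / 2.
have d_gt0 : 0 < d by rewrite divr_gt0// lt_min d00.
have [dd0 dd1] : d < d0 /\ d < d1.
  by split; rewrite /d ltr_pdivrMr// gt_min; apply/orP; [left|right]; lra.
have r0 : 0 < d / 2 / M by apply: divr_gt0 => //; apply: divr_gt0.
exists (G p); apply: (nbhs_distP (G p) P).2; exists (d / 2 / M) => // y yr.
pose T a := a - (G a - y) *m invmx L.
have T_lip a b : `|a - p| <= d -> `|b - p| <= d -> `|T a - T b| <= 1 / 2 * `|a - b|.
  move=> ad bd.
  have -> : T a - T b = - ((G a - G b - (a - b) *m L) *m invmx L).
    rewrite mulmxBl mulmxK// /T !mulmxBl.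
    by apply/matrixP => i j; rewrite !mxE; ring.
  rewrite normrN (le_trans (mulL _))//.
  have := d1E a b (le_lt_trans ad dd1) (le_lt_trans bd dd1).
  move/(ler_wpM2l (ltW M0))/le_trans; apply.
  by rewrite mulrA [M * _]mulrC divfK ?gt_eqF.
pose U := [set a : 'rV[R]_n | `|a - p| <= d].
have pU : U p by rewrite /U /= subrr normr0 ltW.
have TU : set_fun U U T.
  move=> a aU; rewrite /U /= (le_trans (ler_distD (T p) _ _))// (splitr d) lerD//.
    rewrite (le_trans (T_lip _ _ aU pU))// mulrC mul1r ler_wpM2r//.
  have -> : T p - p = (y - G p) *m invmx L.
    by rewrite /T addrAC subrr add0r -mulNmx opprB.
  rewrite (le_trans (mulL _))// distrC -ler_pdivlMl// mulrC ltW//.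
pose F : {fun U >-> U} := mkfun TU.
have Ucl : closed U.
  rewrite (_ : U = closed_ball p d); first exact: closed_ball_closed.
  rewrite closed_ballE//; apply/seteqP; split=> a; rewrite /U /closed_ball_ /=;
    by rewrite distrC.
have Fc : is_contraction F.
  exists (NngNum (divr_ge0 ler01 (ler0n R 2))); split=> /=.
    by lra.
  by move=> [a b] [/= aU bU]; exact: T_lip.
have [a aU] := banach_fixed_point Fc Ucl (ex_intro _ p pU).
rewrite /= -[F a]/(T a) /T => /eqP; rewrite eq_sym addrC -subr_eq0 addrK oppr_eq0.
move=> /eqP Ga.
have -> : y = G a.
  by apply/esym/eqP; rewrite -subr_eq0 -[X in X == _](mulmxKV uL) Ga mul0mx.
by apply: GP; exact: le_lt_trans aU dd0.
Qed.

Lemma strict_diff_flow_core {k n : nat} X q N c phi V W (G : 'rV[R]_k -> 'rV[R]_n) p L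
    (s e : R) :
  local_flow X q N c phi V W -> strict_diff G p L -> G p = q -> `|s| < c -> 0 < e ->
  exists2 d : R, 0 < d & forall a b (t t' eta : R),
    `|a - p| < d -> `|b - p| < d -> `|t - s| < d -> `|t' - s| < d ->
    `|t - t'| <= eta -> `|a - b| <= eta ->
    `|phi t (G a) - phi t' (G b) - ((t - t') *: X (phi s q) + (a - b) *m (L *m V s))|
      <= e * eta.
Proof.
move=> lf GL Gp sc e0.
have [K [d1 [K0 d10 GK]]] := strict_diff_lip GL.
have K1 : 0 < 1 + K by rewrite ltr_wpDr.
have e1 : 0 < e / (2 * (1 + K)) by rewrite divr_gt0// mulr_gt0.
have [d2 d20 phiE] := flow_strict lf sc e1.
pose M := n%:R * `|V s| + 1.
have M0 : 0 < M by rewrite /M ltr_wpDl// mulr_ge0.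
have e2 : 0 < e / (2 * M) by rewrite divr_gt0// mulr_gt0.
have [d3 d30 GE] := GL _ e2.
pose d := Num.min (Num.min d1 d2) (Num.min d3 (d2 / (1 + K))).
have d0 : 0 < d by rewrite /d !lt_min d10 d20 d30 divr_gt0.
have dd x : x < d -> [/\ x < d1, x < d2, x < d3 & x < d2 / (1 + K)].
  by rewrite /d !lt_min => /andP[/andP[-> ->] /andP[-> ->]].
exists d => // a b t t' eta ad bd td t'd te ae.
have [a1 _ a3 a4] := dd _ ad; have [b1 _ b3 b4] := dd _ bd.
have [_ t2 _ _] := dd _ td; have [_ t'2 _ _] := dd _ t'd.
have pd1 : `|p - p| < d1 by rewrite subrr normr0.
have Gq a' : `|a' - p| < d1 -> `|a' - p| < d2 / (1 + K) -> `|G a' - q| < d2.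
  move=> h; rewrite ltr_pdivlMr// => h'; rewrite -Gp (le_lt_trans (GK _ _ h pd1))//.
  by rewrite (le_lt_trans _ h')// mulrC ler_wpM2l// lerDr.
have eta0 : 0 <= eta by rewrite (le_trans _ ae).
have -> : phi t (G a) - phi t' (G b) - ((t - t') *: X (phi s q) + (a - b) *m (L *m V s)) =
  (phi t (G a) - phi t' (G b) - (t - t') *: X (phi s q) - (G a - G b) *m V s) +
  (G a - G b - (a - b) *m L) *m V s.
  rewrite [X in _ = _ + X]mulmxBl mulmxA.
  by apply/matrixP => i j; rewrite !mxE; ring.
rewrite (le_trans (ler_normD _ _))// (splitr e) mulrDl lerD//.
  rewrite (le_trans (phiE _ _ _ _ (Gq _ a1 a4) (Gq _ b1 b4) t2 t'2))//.
  have -> : e / 2 * eta = e / (2 * (1 + K)) * (eta + K * eta).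
    by field; rewrite gt_eqF.
  rewrite ler_wpM2l ?(ltW e1)// lerD// (le_trans (GK _ _ a1 b1))// ler_wpM2l//.
have -> : e / 2 * eta = e / (2 * M) * eta * M by field; rewrite gt_eqF.
rewrite (le_trans (mulmx_norm_le _ _))// mulrAC mulrC.
have h := GE _ _ a3 b3.
apply: ler_pM => //.
  by rewrite (le_trans h)// ler_wpM2l// ltW.
by rewrite /M lerDl ler01.
Qed.

Lemma strict_diff_flow {k n : nat} X q N c phi V W (G : 'rV[R]_k -> 'rV[R]_n) p L
    (s : R) :
  local_flow X q N c phi V W -> strict_diff G p L -> G p = q -> `|s| < c ->
  strict_diff (phi s \o G) p (L *m V s).
Proof.
move=> lf GL Gp sc e e0.
have [d d0 dE] := strict_diff_flow_core lf GL Gp sc e0.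
exists d => // a b ad bd.
have sd : `|s - s| < d by rewrite subrr normr0.
have := dE a b s s _ ad bd sd sd _ (lexx _).
by rewrite subrr scale0r add0r normr0; apply.
Qed.

(* The switching time becomes the first parameter. *)
Lemma strict_diff_flow_time {k n : nat} X q N c phi V W (G : 'rV[R]_k -> 'rV[R]_n) p L
    (s : R) :
  local_flow X q N c phi V W -> strict_diff G p L -> G p = q -> `|s| < c ->
  strict_diff (fun b : 'rV[R]_(1 + k) => phi (b 0 (lshift k 0)) (G (rsubmx b)))
    (row_mx s%:M p) (col_mx (X (phi s q)) (L *m V s)).
Proof.
move=> lf GL Gp sc e e0.
have [d d0 dE] := strict_diff_flow_core lf GL Gp sc e0.
have rs (b : 'rV[R]_(1 + k)) : `|rsubmx b| <= `|b|.
  by apply: mx_norm_leP => // i j; rewrite mxE; exact: mx_coord_le.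
exists d => // a b ad bd.
have ra (u : 'rV[R]_(1 + k)) : `|u - row_mx s%:M p| < d ->
    `|rsubmx u - p| < d /\ `|u 0 (lshift k 0) - s| < d.
  move=> ud; split.
    have -> : rsubmx u - p = rsubmx (u - row_mx s%:M p) by rewrite linearB/= row_mxKr.
    exact: le_lt_trans (rs _) ud.
  have -> : u 0 (lshift k 0) - s = (u - row_mx s%:M p) 0 (lshift k 0).
    by rewrite [RHS]mxE [X in _ = _ + X]mxE row_mxEl mxE eqxx mulr1n.
  exact: le_lt_trans (mx_coord_le _ _ _) ud.
have [ra1 ra2] := ra _ ad; have [rb1 rb2] := ra _ bd.
have := dE _ _ _ _ `|a - b| ra1 rb1 ra2 rb2.
have -> : (a - b) *m col_mx (X (phi s q)) (L *m V s) =
  (a 0 (lshift k 0) - b 0 (lshift k 0)) *: X (phi s q) +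
  (rsubmx a - rsubmx b) *m (L *m V s).
  rewrite -{1}(hsubmxK (a - b)) mul_row_col linearB/= linearB/=; congr (_ + _).
  rewrite (_ : lsubmx a - lsubmx b = (a 0 (lshift k 0) - b 0 (lshift k 0))%:M).
    by rewrite mul_scalar_mx.
  by apply/matrixP => i j; rewrite !mxE !ord1 eqxx mulr1n.
apply.
  by have := mx_coord_le (a - b) 0 (lshift k 0); rewrite !mxE.
by rewrite -linearB/=; exact: rs.
Qed.

End StrictDiff.

(** * Calculus of smooth maps *)

Lemma dist_lt_split {R : realFieldType} {V : normedZmodType R} (a b c : V) (e : R) :
  `|a - c| < e / 2 -> `|b - c| < e / 2 -> `|a - b| < e.
Proof.
move=> ac bc; rewrite (le_lt_trans (ler_distD c _ _))// (splitr e) ltrD//.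
by rewrite distrC.
Qed.

Section SmoothCalculus.
Context {R : realType} {V : normedModType R}.

Lemma CkS {W : normedModType R} k (f : V -> W) : Ck k.+1 f -> Ck k f.
Proof.
elim: k f => [|k ih] f /= [df dfk].
  by move=> x; exact: differentiable_continuous.
by split=> // v; apply: ih; exact: dfk.
Qed.

Lemma CkD {W : normedModType R} k (f g : V -> W) : Ck k f -> Ck k g ->
  Ck k (f \+ g).
Proof.
elim: k f g => [|k ih] f g /=.
  by move=> fc gc x; apply: cvgD; [exact: fc|exact: gc].
move=> [df dfk] [dg dgk]; split=> [x|v]; first exact: differentiableD.
rewrite (_ : 'D_v (f \+ g) = 'D_v f \+ 'D_v g); first exact: ih.
by apply/funext => x; rewrite deriveD//; exact: diff_derivable.
Qed.

Lemma Ck_cst {W : normedModType R} k (w : W) : Ck k (cst w : V -> W).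
Proof.
elim: k w => [|k ih] w /=; first by move=> x; exact: cvg_cst.
split=> [x|v]; first exact: differentiable_cst.
rewrite (_ : 'D_v (cst w) = cst 0); first exact: ih.
by apply/funext => x; rewrite derive_cst.
Qed.

Lemma Ck_sum {W : normedModType R} k n (f : 'I_n -> V -> W) :
  (forall i, Ck k (f i)) -> Ck k (fun x => \sum_(i < n) f i x).
Proof.
move=> fk; elim: n f fk => [|n ih] f fk.
  rewrite (_ : (fun x => _) = cst 0); first exact: Ck_cst.
  by apply/funext => x; rewrite big_ord0.
rewrite (_ : (fun x => _) =
  (fun x => \sum_(i < n) f (widen_ord (leqnSn n) i) x) \+ f ord_max).
  by apply: CkD => //; exact: ih.
by apply/funext => x; rewrite big_ord_recr.
Qed.

Lemma CkM k (f g : V -> R) : Ck k f -> Ck k g -> Ck k (fun x => f x * g x).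
Proof.
elim: k f g => [|k ih] f g.
  by move=> fc gc x; apply: cvgM; [exact: fc|exact: gc].
move=> fk gk; have [[df dfk] [dg dgk]] := (fk, gk).
split=> [x|v]; first exact: differentiableM.
rewrite (_ : 'D_v (fun x => f x * g x) =
    (fun x => f x * 'D_v g x) \+ (fun x => g x * 'D_v f x)).
  by apply: CkD; apply: ih; [exact: CkS|exact: dgk|exact: CkS|exact: dfk].
apply/funext => x; rewrite (_ : (fun x => f x * g x) = f * g)//.
by rewrite deriveM//; exact: diff_derivable.
Qed.

Lemma CkN k (f : V -> R) : Ck k f -> Ck k (fun x => - f x).
Proof.
move=> fk; rewrite (_ : (fun x => _) = fun x => cst (-1) x * f x).
  by apply: CkM => //; exact: Ck_cst.
by apply/funext => x; rewrite /cst mulN1r.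
Qed.

Lemma CkB k (f g : V -> R) : Ck k f -> Ck k g -> Ck k (fun x => f x - g x).
Proof. by move=> fk gk; apply: (@CkD _ k f (fun x => - g x)) => //; exact: CkN. Qed.

Lemma derive_coord n (f : V -> 'rV[R]_n) (x v : V) j : differentiable f x ->
  'D_v (fun y => f y 0 j) x = 'D_v f x 0 j.
Proof. by move=> df; rewrite (derive_mx (diff_derivable _)) ?mxE. Qed.

Lemma differentiable_rowP n (f : V -> 'rV[R]_n) x :
  differentiable f x <-> forall j, differentiable (fun y => f y 0 j) x.
Proof.
split=> [df j|df].
  apply: (@differentiable_comp _ _ _ _ f (fun M : 'rV[R]_n => M 0 j)) => //.
  exact: differentiable_coord.
have fE : f = \sum_(j < n) (fun y => f y 0 j *: delta_mx 0 j).
  by apply/funext => y; rewrite fct_sumE [LHS]row_sum_delta.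
rewrite fE; apply: differentiable_sum => j; exact: differentiableZl.
Qed.

Lemma Ck_rowP k n (f : V -> 'rV[R]_n) :
  Ck k f <-> forall j, Ck k (fun y => f y 0 j).
Proof.
elim: k f => [|k ih] f /=.
  split=> [fc j x|fc x].
    by apply: (@continuous_comp _ _ _ f (fun M : 'rV[R]_n => M 0 j));
      [exact: fc|exact: coord_continuous].
  by apply: cvg_mxP => i j; rewrite ord1; exact: fc.
split=> [[df dfk] j|fk].
  split=> [x|v]; first exact: (differentiable_rowP f x).1 (df x) j.
  rewrite (_ : 'D_v _ = fun x => 'D_v f x 0 j); first by apply/ih: j.
  by apply/funext => x; exact: derive_coord.
have df x : differentiable f x by apply/differentiable_rowP => j; have [+ _] := fk j.
split=> // v; apply/ih => j.
rewrite (_ : (fun y => _) = 'D_v (fun y => f y 0 j)); first by have [_] := fk j.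
by apply/funext => x; rewrite derive_coord.
Qed.

Lemma smooth_rowP n (f : V -> 'rV[R]_n) :
  smooth f <-> forall j, smooth (fun y => f y 0 j).
Proof.
split=> [fs j k|fs k]; first by have /Ck_rowP := fs k; exact.
by apply/Ck_rowP => j; exact: fs.
Qed.

Lemma derive_line (f : V -> R) (y w : V) (h : R) : (forall x, differentiable f x) ->
  0 < h -> exists2 s, 0 < s < h & f (y + h *: w) - f y = h * 'D_w f (y + s *: w).
Proof.
move=> df h0.
have dl (s : R) : is_derive s 1 (fun s : R => y + s *: w) w.
  have := is_deriveD (is_derive_cst y s (1 : R)) (is_derive_scalel w s).
  by rewrite add0r.
have dfl (s : R) : is_derive s 1 (fun s => f (y + s *: w)) ('D_w f (y + s *: w)).
  by rewrite deriveE//; exact: (is_derive_diff_comp (dl s)).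
have fc : {within `[0, h], continuous (fun s => f (y + s *: w))}.
  by apply: derivable_within_continuous => s _; have [] := dfl s.
have [s + sE] := MVT h0 (fun s _ => dfl s) fc.
rewrite in_itv/= => sh; exists s => //.
by move: sE; rewrite scale0r addr0 subr0 mulrC.
Qed.

Lemma schwarz (f : V -> R) (u v x : V) : smooth f ->
  'D_u ('D_v f) x = 'D_v ('D_u f) x.
Proof.
move=> fs.
have df := smooth_differentiable fs.
have ds w := smooth_differentiable (smooth_derive w fs).
have dc w w' : continuous ('D_w ('D_w' f)).
  exact: smooth_continuous (smooth_derive w (smooth_derive w' fs)).
have key (a b : V) (h : R) : 0 < h ->
  exists2 z, `|x - z| <= h * (`|a| + `|b|) &
    f (x + h *: a + h *: b) - f (x + h *: a) - (f (x + h *: b) - f x) =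
    h * (h * 'D_b ('D_a f) z).
  move=> h0.
  pose g y := f (y + h *: b) - f y.
  have dshift y : differentiable (fun y : V => y + h *: b) y.
    exact: differentiableD.
  have dgb y : differentiable (fun y => f (y + h *: b)) y.
    exact: (@differentiable_comp _ _ _ _ (fun y => y + h *: b) f).
  have dg y : differentiable g y by exact: differentiableB.
  have [s /andP[s0 sh] sE] := derive_line x a dg h0.
  have gE y : 'D_a g y = 'D_a f (y + h *: b) - 'D_a f y.
    have -> : g = (fun y => f (y + h *: b)) - f by [].
    rewrite deriveB; [|exact: diff_derivable|exact: diff_derivable].
    congr (_ - _).
    rewrite /derive; set F := (F in lim (F @ _) = _); set G := (G in _ = lim (G @ _)).
    by have -> : F = G by apply/funext => k; rewrite /F /G /= addrA.
  have [t /andP[t0 th] tE] := derive_line (x + s *: a) b (ds a) h0.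
  exists (x + s *: a + t *: b).
    rewrite -addrA opprD addrA subrr add0r normrN.
    rewrite (le_trans (ler_normD _ _))// !normrZ mulrDr !gtr0_norm//.
    by rewrite lerD// ler_wpM2r// ltW.
  by rewrite -tE -gE -sE /g addrAC.
apply/eqP; rewrite -subr_eq0 -normr_le0; apply/ler_addgt0Pr => e e0.
rewrite add0r.
have e2 : 0 < e / 2 by rewrite divr_gt0.
have /continuous_distP/(_ _ e2)[d1 d10 d1E] := dc u v x.
have /continuous_distP/(_ _ e2)[d2 d20 d2E] := dc v u x.
pose d := Num.min d1 d2 / 2.
pose h := d / (`|u| + `|v| + 1).
have uv0 : 0 < `|u| + `|v| + 1 by rewrite ltr_wpDl// addr_ge0.
have d0 : 0 < d by rewrite divr_gt0// lt_min d10 d20.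
have h0 : 0 < h by rewrite divr_gt0.
have hd : h * (`|u| + `|v|) <= d.
  rewrite /h mulrAC ler_pdivrMr// ler_wpM2l ?(ltW d0)// lerDl.
  exact: ler01.
have [dd1 dd2] : d < d1 /\ d < d2.
  by split; rewrite /d ltr_pdivrMr// gt_min; apply/orP; [left|right]; lra.
have [z zx zE] := key u v h h0.
have [z' z'x z'E] := key v u h h0.
have zz' : 'D_v ('D_u f) z = 'D_u ('D_v f) z'.
  have hn := lt0r_neq0 h0; have sw := addrAC x (h *: u) (h *: v).
  move: zE z'E; rewrite sw; move: (f _) (f _) (f _) (f _) => f1 f2 f3 f4.
  move: ('D_v _ _) ('D_u _ _) => a b aE bE.
  by apply: (mulfI hn); apply: (mulfI hn); rewrite -aE -bE; ring.
have := d1E z' (le_lt_trans z'x (le_lt_trans _ dd1)).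
rewrite (addrC `|v|) => /(_ hd) h1.
have := d2E z (le_lt_trans zx (le_lt_trans hd dd2)).
rewrite zz' => h2.
exact: ltW (dist_lt_split h1 h2).
Qed.

End SmoothCalculus.

Section SmoothClosure.
Context {R : realType} {V W : normedModType R}.

Lemma CkZ k (a : R) (f : V -> W) : Ck k f -> Ck k (fun x => a *: f x).
Proof.
elim: k f => [|k ih] f /=.
  by move=> fc x; apply: cvgZr; exact: fc.
move=> [df dfk]; split=> [x|v]; first exact: differentiableZ.
rewrite (_ : 'D_v (fun x => a *: f x) = fun x => a *: 'D_v f x); first exact: ih.
by apply/funext => x; rewrite deriveZ//; exact: diff_derivable.
Qed.

Lemma smoothD (f g : V -> W) : smooth f -> smooth g -> smooth (f \+ g).
Proof. by move=> fs gs k; apply: CkD. Qed.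

Lemma smoothZ (a : R) (f : V -> W) : smooth f -> smooth (fun x => a *: f x).
Proof. by move=> fs k; apply: CkZ. Qed.

Lemma smooth_cst (w : W) : smooth (cst w : V -> W).
Proof. by move=> k; exact: Ck_cst. Qed.

Lemma smooth_sum n (f : 'I_n -> V -> W) :
  (forall i, smooth (f i)) -> smooth (fun x => \sum_(i < n) f i x).
Proof. by move=> fs k; apply: Ck_sum => i; exact: fs. Qed.

End SmoothClosure.

(** * Lie brackets *)

Section LieBracket.
Context {R : realType} {n : nat}.
Local Notation vfield := ('rV[R]_n -> 'rV[R]_n).
Implicit Types (X Y Z : vfield) (f g : 'rV[R]_n -> R).

Lemma rowB (A B : 'rV[R]_n) j : (A - B) 0 j = A 0 j - B 0 j.
Proof. by rewrite !mxE. Qed.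

Definition lie_derivative X f (x : 'rV[R]_n) : R :=
  \sum_(i < n) X x 0 i * 'D_(delta_mx 0 i) f x.

Lemma smooth_lie_derivative X f : smooth X -> smooth f -> smooth (lie_derivative X f).
Proof.
move=> /smooth_rowP Xs fs k; apply: Ck_sum => i; apply: CkM; first exact: Xs.
exact: smooth_derive.
Qed.

Lemma lie_bracketE X Y x j : smooth X -> smooth Y -> lie_bracket X Y x 0 j =
  lie_derivative X (fun y => Y y 0 j) x - lie_derivative Y (fun y => X y 0 j) x.
Proof.
move=> Xs Ys.
have dE Z Z' : smooth Z -> 'd Z x (Z' x) 0 j = lie_derivative Z' (fun y => Z y 0 j) x.
  move=> Zs; rewrite (diff_delta _ (smooth_differentiable Zs x)) summxE.
  apply: eq_bigr => i _; rewrite mxE derive_coord//.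
  exact: smooth_differentiable.
have -> : lie_bracket X Y x 0 j = 'd Y x (X x) 0 j - 'd X x (Y x) 0 j by rewrite !mxE.
by congr (_ - _); apply: dE.
Qed.

Lemma smooth_lie_bracket X Y : smooth X -> smooth Y -> smooth (lie_bracket X Y).
Proof.
move=> Xs Ys; apply/smooth_rowP => j.
rewrite (_ : (fun y => _) = fun x => lie_derivative X (fun y => Y y 0 j) x -
                            lie_derivative Y (fun y => X y 0 j) x).
  by move=> k; apply: CkB; apply: smooth_lie_derivative => //;
    [move/smooth_rowP : Ys; exact|move/smooth_rowP : Xs; exact].
by apply/funext => x; exact: lie_bracketE.
Qed.

Lemma lie_derivativeB X f g x : smooth f -> smooth g ->
  lie_derivative X (fun y => f y - g y) x =
  lie_derivative X f x - lie_derivative X g x.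
Proof.
move=> /smooth_differentiable df /smooth_differentiable dg.
rewrite /lie_derivative -sumrB; apply: eq_bigr => i _.
rewrite (_ : (fun y => f y - g y) = f - g)//.
by rewrite deriveB ?mulrBr//; exact: diff_derivable.
Qed.

Lemma derive_lie_derivative X f (v x : 'rV[R]_n) : smooth X -> smooth f ->
  'D_v (lie_derivative X f) x =
  \sum_(i < n) ('D_v (fun y => X y 0 i) x * 'D_(delta_mx 0 i) f x +
                X x 0 i * 'D_v ('D_(delta_mx 0 i) f) x).
Proof.
move=> /smooth_rowP Xs fs.
have dXf i : differentiable ((fun y => X y 0 i) * 'D_(delta_mx 0 i) f) x.
  apply: differentiableM; first exact: (smooth_differentiable (Xs i)).
  exact: (smooth_differentiable (smooth_derive _ fs)).
rewrite (_ : lie_derivative X f =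
    \sum_(i < n) ((fun y => X y 0 i) * 'D_(delta_mx 0 i) f)); last first.
  by apply/funext => y; rewrite fct_sumE.
rewrite derive_sum => [|i]; last exact: diff_derivable.
apply: eq_bigr => i _; rewrite deriveM.
- by rewrite addrC; congr (_ + _); rewrite /GRing.scale/= mulrC.
- exact/diff_derivable/(smooth_differentiable (Xs i)).
- exact/diff_derivable/(smooth_differentiable (smooth_derive _ fs)).
Qed.

(* The second-order terms cancel by the symmetry of second derivatives. *)
Lemma lie_derivative_bracket X Y f x : smooth X -> smooth Y -> smooth f ->
  lie_derivative (lie_bracket X Y) f x =
  lie_derivative X (lie_derivative Y f) x - lie_derivative Y (lie_derivative X f) x.
Proof.
move=> Xs Ys fs.
pose D (i : 'I_n) f := 'D_(delta_mx 0 i : 'rV[R]_n) f.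
pose first_order X Y := \sum_(i < n) \sum_(k < n)
  X x 0 i * (D i (fun y => Y y 0 k) x * D k f x).
pose second_order X Y := \sum_(i < n) \sum_(k < n)
  X x 0 i * (Y x 0 k * D i (D k f) x).
have LL Z T : smooth T -> lie_derivative Z (lie_derivative T f) x =
    first_order Z T + second_order Z T.
  move=> Ts; rewrite /first_order /second_order -big_split; apply: eq_bigr => i _.
  rewrite derive_lie_derivative// mulr_sumr -big_split; apply: eq_bigr => k _ /=.
  by rewrite mulrDr.
have second_sym : second_order X Y = second_order Y X.
  rewrite /second_order exchange_big; apply: eq_bigr => k _; apply: eq_bigr => i _.
  by rewrite /D schwarz// mulrCA.
rewrite !LL// second_sym opprD addrACA subrr addr0.
rewrite /first_order [X in _ = X - _]exchange_big [X in _ = _ - X]exchange_big -sumrB.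
apply: eq_bigr => k _; rewrite lie_bracketE// mulrBl; congr (_ - _);
  by rewrite mulr_suml; apply: eq_bigr => i _; rewrite mulrA.
Qed.

Lemma lie_bracketC X Y x : lie_bracket X Y x = - lie_bracket Y X x.
Proof. by rewrite /lie_bracket opprB. Qed.

Lemma lie_bracket_bracketE X Y Z x j : smooth X -> smooth Y -> smooth Z ->
  let L := lie_derivative in let c (T : vfield) := fun y => T y 0 j in
  lie_bracket (lie_bracket X Y) Z x 0 j =
  (L X (L Y (c Z)) x - L Y (L X (c Z)) x) -
  (L Z (L X (c Y)) x - L Z (L Y (c X)) x).
Proof.
move=> Xs Ys Zs L c; have XYs := smooth_lie_bracket Xs Ys.
have cs (T : vfield) : smooth T -> smooth (c T) by move=> /smooth_rowP; exact.
apply: etrans (lie_bracketE x j XYs Zs) _.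
apply: (f_equal2 (fun a b : R => a - b)).
  exact: lie_derivative_bracket (cs _ Zs).
have brE : (fun y => lie_bracket X Y y 0 j) = (fun y => L X (c Y) y - L Y (c X) y).
  by apply/funext => y; exact: lie_bracketE.
apply: etrans (congr1 (fun h => lie_derivative Z h x) brE) _.
by apply: lie_derivativeB; apply: smooth_lie_derivative; rewrite //; exact: cs.
Qed.

Lemma jacobi X Y Z : smooth X -> smooth Y -> smooth Z ->
  lie_bracket (lie_bracket X Y) Z =
  lie_bracket X (lie_bracket Y Z) \- lie_bracket Y (lie_bracket X Z).
Proof.
move=> Xs Ys Zs; apply/funext => x; apply/rowP => j.
have scal (l1 l2 l3 a b c d e f : R) : l1 = (a - b) - (c - d) ->
    l2 = (e - d) - (a - f) -> l3 = (f - c) - (b - e) -> l1 = - l2 - - l3.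
  by move=> -> -> ->; ring.
have := scal _ _ _ _ _ _ _ _ _ (lie_bracket_bracketE x j Xs Ys Zs)
  (lie_bracket_bracketE x j Ys Zs Xs) (lie_bracket_bracketE x j Xs Zs Ys).
move=> h; apply: etrans h _.
apply: etrans (esym (rowB (lie_bracket X (lie_bracket Y Z) x) _ j)).
have oppE (A B : 'rV[R]_n) : A = - B -> - B 0 j = A 0 j by move=> ->; rewrite mxE.
by apply: (f_equal2 (fun a b : R => a - b)); apply: oppE; exact: lie_bracketC.
Qed.

Lemma lie_bracketDl X Y Z : smooth X -> smooth Y ->
  lie_bracket (X \+ Y) Z = lie_bracket X Z \+ lie_bracket Y Z.
Proof.
move=> Xs Ys; apply/funext => x.
have dX := smooth_differentiable Xs x; have dY := smooth_differentiable Ys x.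
have h1 : 'd Z x (X x + Y x) = 'd Z x (X x) + 'd Z x (Y x) by exact: linearD.
have h2 : 'd (X \+ Y) x (Z x) = 'd X x (Z x) + 'd Y x (Z x).
  apply: etrans (esym (deriveE (Z x) (differentiableD dX dY))) _.
  apply: etrans (f_equal2 +%R (deriveE (Z x) dX) (deriveE (Z x) dY)).
  by apply: deriveD; exact: diff_derivable.
have ACA (a b c d : 'rV[R]_n) : a + b - (c + d) = (a - c) + (b - d).
  by rewrite opprD addrACA.
exact: etrans (f_equal2 (fun a b : 'rV[R]_n => a - b) h1 h2) (ACA _ _ _ _).
Qed.

Lemma lie_bracketZl (a : R) X Z : smooth X ->
  lie_bracket (fun x => a *: X x) Z = fun x => a *: lie_bracket X Z x.
Proof.
move=> Xs; apply/funext => x.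
have dX := smooth_differentiable Xs x.
have h1 : 'd Z x (a *: X x) = a *: 'd Z x (X x) by exact: linearZ.
have h2 : 'd (fun x => a *: X x) x (Z x) = a *: 'd X x (Z x).
  apply: etrans (esym (deriveE (Z x) (differentiableZ a dX))) _.
  apply: etrans (congr1 (fun v => a *: v) (deriveE (Z x) dX)).
  by apply: deriveZ; exact: diff_derivable.
apply: etrans (f_equal2 (fun a b : 'rV[R]_n => a - b) h1 h2) _.
exact: esym (scalerBr a _ _).
Qed.

End LieBracket.

Lemma lie_bracket0l {R : realType} {n : nat} (Z : 'rV[R]_n -> 'rV[R]_n) :
  lie_bracket (cst 0) Z = cst 0.
Proof.
apply/funext => x; rewrite /lie_bracket.
have h1 : 'd Z x (cst 0 x) = 0 by exact: linear0.
have h2 : 'd (cst 0 : 'rV[R]_n -> 'rV[R]_n) x (Z x) = 0.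
  exact: etrans (esym (deriveE (Z x) (differentiable_cst 0 x))) (derive_cst 0 x (Z x)).
exact: etrans (f_equal2 (fun a b : 'rV[R]_n => a - b) h1 h2) (subr0 0).
Qed.

Lemma lie_algebra_smooth {R : realType} {n : nat} :
  lie_algebra (smooth : set ('rV[R]_n -> 'rV[R]_n)).
Proof.
split=> //.
- exact: smooth_cst.
- by move=> X Y; exact: smoothD.
- by move=> a X; exact: smoothZ.
- by move=> X Y; exact: smooth_lie_bracket.
Qed.

(** * Concatenation of trajectories *)

Section Trajectories.
Context {R : realType} {n m : nat}.
Variables (f0 : 'rV[R]_n -> 'rV[R]_n) (g : 'I_m -> 'rV[R]_n -> 'rV[R]_n).
Variables (ulo uhi : 'I_m -> 'rV[R]_n -> R).

(* Lipschitz trajectories driven by bounded measurable controls defined on the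
   whole line: unlike [reachable], this notion allows [tau = 0] and is stable
   under concatenation. *)
Definition steered (N : set 'rV[R]_n) (xe : 'rV[R]_n) (tau : R) (y : 'rV[R]_n) : Prop :=
  exists (x : R -> 'rV[R]_n) (u : R -> 'rV[R]_m) (K B : R) (E : set R),
  [/\ forall s t, 0 <= s -> s <= t -> t <= tau -> `|x t - x s| <= K * (t - s),
      (forall i, measurable_fun [set: R] (fun t => u t 0 i)) /\
        (forall t i, `|u t 0 i| <= B),
      lebesgue_measure.-negligible E /\
        (forall t : R, 0 < t < tau -> ~ E t ->
          Omega ulo uhi (x t) (u t) /\ is_derive t 1 x (rhs f0 g (x t) (u t))),
      forall t, 0 <= t <= tau -> N (x t)
    & x 0 = xe /\ x tau = y].

Lemma steered0 (N : set 'rV[R]_n) xe : N xe -> steered N xe 0 xe.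
Proof.
move=> Nxe; exists (cst xe), (cst 0), 0, 0, set0; split=> //.
- by move=> s t _ _ _; rewrite subrr normr0 mul0r.
- by split=> [i|t i]; [exact: measurable_cst|rewrite /cst mxE normr0].
- split; first exact: negligible_set0.
  by move=> t /andP[t0 t1]; have := lt_trans t0 t1; rewrite ltxx.
Qed.

Lemma steered_step (N : set 'rV[R]_n) xe tau y (z : R -> 'rV[R]_n) (v : 'rV[R]_m)
    (s K : R) :
  0 <= tau -> 0 <= s -> steered N xe tau y -> z 0 = y ->
  (forall a b, 0 <= a -> a <= b -> b <= s -> `|z b - z a| <= K * (b - a)) ->
  (forall t : R, 0 <= t <= s -> [/\ N (z t), Omega ulo uhi (z t) v &
    is_derive t 1 z (rhs f0 g (z t) v)]) ->
  steered N xe (tau + s) (z s).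
Proof.
move=> tau0 s0 [x [u [K' [B [E [xlip [um uB] [E0 xE] xN [x0 xtau]]]]]]] z0 zlip zE.
pose x' t := if t <= tau then x t else z (t - tau).
pose u' t := if t <= tau then u t else v.
have x'1 t : t <= tau -> x' t = x t by rewrite /x' => ->.
have x'2 t : tau <= t -> x' t = z (t - tau).
  rewrite /x' le_eqVlt => /predU1P[<-|]; first by rewrite lexx subrr z0.
  by rewrite ltNge => /negbTE ->.
exists x', u', (`|K| + `|K'|), (`|B| + `|v|), (E `|` [set tau]).
have KK (a b c d : R) : 0 <= a -> 0 <= b -> c <= K' * a -> d <= K * b ->
    c + d <= (`|K| + `|K'|) * (a + b).
  move=> a0 b0 ca db; have k1 := ler_norm K; have k2 := ler_norm K'.
  have k3 := normr_ge0 K; have k4 := normr_ge0 K'.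
  move: (`|K|) (`|K'|) k1 k2 k3 k4 => p q pK qK p0 q0.
  have := ler_wpM2r a0 qK; have := ler_wpM2r b0 pK.
  have := mulr_ge0 p0 a0; have := mulr_ge0 q0 b0; lra.
split.
- move=> a b a0 ab bts.
  have [bt|tb] := leP b tau.
    rewrite (x'1 a (le_trans ab bt)) (x'1 b bt) -[`|_|]addr0 -[b - a]addr0.
    apply: KK; rewrite ?subr_ge0 ?mulr0//; exact: xlip.
  have [at_|ta] := leP a tau.
    rewrite (x'1 a at_) (x'2 b (ltW tb)).
    have -> : z (b - tau) - x a = (x tau - x a) + (z (b - tau) - z 0).
      by rewrite xtau z0 [RHS]addrC [RHS]addrA subrK.
    have -> : b - a = (tau - a) + (b - tau) by ring.
    rewrite (le_trans (ler_normD _ _))//.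
    apply: KK; rewrite ?subr_ge0// ?(ltW tb)//; first exact: xlip.
    rewrite -[X in K * X]subr0; apply: zlip => //; first by rewrite subr_ge0 ltW.
    by rewrite lerBlDl.
  rewrite (x'2 a (ltW ta)) (x'2 b (ltW tb)) -[`|_|]add0r -[b - a]add0r.
  apply: KK; rewrite ?subr_ge0 ?mulr0//.
  have -> : b - a = (b - tau) - (a - tau) by ring.
  by apply: zlip; rewrite ?subr_ge0 ?(ltW ta)// ?lerD2r// lerBlDl.
- split=> [i|t i].
    have -> : (fun t => u' t 0 i) = fun t => if t <= tau then u t 0 i else v 0 i.
      by apply/funext => t; rewrite /u'; case: ifP.
    apply: measurable_fun_ifT; [|exact: um|exact: measurable_cst].
    by apply: measurable_realfun.measurable_fun_ler;
      [exact: measurable_id|exact: measurable_cst].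
  rewrite /u'; case: ifPn => _.
    by rewrite (le_trans (uB _ _))// (le_trans (ler_norm _))// lerDl.
  by rewrite (le_trans (mx_coord_le _ _ _))// lerDr.
- split.
    apply: negligibleU => //; apply/negligibleP; first exact: measurable_set1.
    exact: lebesgue_measure_set1.
  move=> t /andP[t0 ts] nE.
  have [Et ttau] : ~ E t /\ t <> tau by split=> h; apply: nE; [left|right].
  have [tt|tt] := ltP t tau.
    have t01 : 0 < t < tau by rewrite t0.
    have [Om dx] := xE t t01 Et.
    rewrite (x'1 t (ltW tt)) /u' (ltW tt); split=> //.
    apply: near_eq_is_derive dx; apply/nbhs_distP; exists (tau - t).
      by rewrite subr_gt0.
    move=> r tr; rewrite x'1//; move: tr; rewrite distrC => tr.
    by have := ler_norm (r - t); lra.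
  have {ttau}tt : tau < t.
    by rewrite lt_neqAle tt andbT; apply/eqP => /esym.
  have ts' : 0 <= t - tau <= s by rewrite subr_ge0 ltW//= lerBlDl ltW.
  have [_ Om dz] := zE _ ts'.
  rewrite (x'2 t (ltW tt)) /u' leNgt tt/=; split=> //.
  have dsh : is_derive t 1 (fun r : R => r - tau) 1.
    have := is_deriveB (is_derive_id t (1 : R)) (is_derive_cst tau t (1 : R)).
    by rewrite subr0.
  have dzsh : is_derive t 1 (z \o (fun r : R => r - tau)) (rhs f0 g (z (t - tau)) v).
    have [dz1 dz2] := dz; have dz3 := (derivable1_diffP z (t - tau)).1 dz1.
    have e := etrans (esym (deriveE (1 : R) dz3)) dz2.
    exact: is_derive_eq (is_derive_diff_comp dsh dz3) e.
  apply: near_eq_is_derive dzsh; apply/nbhs_distP; exists (t - tau).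
    by rewrite subr_gt0.
  move=> r tr; rewrite /= x'2//.
  by have := ler_norm (t - r); lra.
- move=> t /andP[t0 ts]; have [tt|tt] := leP t tau.
    by rewrite x'1//; apply: xN; rewrite t0.
  rewrite (x'2 t (ltW tt)).
  have ts' : 0 <= t - tau <= s by rewrite subr_ge0 ltW//= lerBlDl.
  by have [] := zE _ ts'.
- by rewrite x'1// x'2 ?lerDl// addrC addKr.
Qed.

Lemma steered_reachable (N : set 'rV[R]_n) xe tau (T : R) y :
  0 <= tau -> tau <= T -> steered N xe tau y -> reachable f0 g ulo uhi T xe N y.
Proof.
rewrite le_eqVlt => /predU1P[<-|tau0] tT.
  by move=> [x [u [K [B [E [_ _ _ _ [x0 xtau]]]]]]]; left; rewrite /= -xtau x0.
move=> [x [u [K [B [E [xlip [um uB] [E0 xE] xN [x0 xtau]]]]]]]; right.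
exists tau, x; split=> //; first by rewrite tau0.
split.
  move=> e e0; have K1 : 0 < `|K| + 1 by rewrite ltr_wpDl.
  exists (e / (`|K| + 1)) => [|k s t st _ sumd]; first by rewrite divr_gt0.
  move: sumd; rewrite ltr_pdivlMr// => sumd; apply: le_lt_trans sumd.
  rewrite mulr_suml ler_sum// => i _; have [si [sti ti]] := st i.
  rewrite (le_trans (xlip _ _ si sti ti))// mulrC ler_wpM2l ?subr_ge0//.
  by rewrite (le_trans (ler_norm _))// lerDl ler01.
exists u; last first.
  apply: negligibleS E0 => t /= nt; apply: contrapT => nE; apply: nt => tin.
  by apply: xE nE; move: tin; rewrite in_itv.
move=> i; apply/andP; split.
  have mI : measurable (`]0, tau[%classic : set R) by exact: measurable_itv.
  by rewrite inE; exact: (measurable_restrictT _ mI).1 (measurable_funTS (um i)).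
rewrite inE/= /finite_norm unlock /=.
case: ifPn => // _; rewrite (@le_lt_trans _ _ `|B|%:E)// ?ltry//.
apply/ess_sup_inf.ess_supP; apply: nearW => t /=.
rewrite lee_fin patchE; case: ifPn => _; last by rewrite normr0.
by rewrite (le_trans (uB _ _))// ler_norm.
Qed.

End Trajectories.

(** * Accessibility *)

Section RightDerivative.
Context {R : realType}.

Lemma is_derive_right0 {V : normedModType R} (h : R -> V) (d : V) (s0 : R) :
  0 < s0 -> is_derive (0 : R) 1 h d -> (forall s, 0 < s < s0 -> h s = 0) ->
  h 0 = 0 /\ d = 0.
Proof.
move=> s00 dh hE.
have small (d0 : R) : 0 < d0 -> exists2 s, 0 < s < s0 & s < d0.
  move=> d00; exists (Num.min s0 d0 / 2).
    rewrite divr_gt0 ?lt_min ?s00//= ltr_pdivrMr// gt_min.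
    by apply/orP; left; lra.
  by rewrite ltr_pdivrMr// gt_min; apply/orP; right; lra.
have h0 : h 0 = 0.
  apply/eqP; rewrite -normr_le0; apply/ler_addgt0Pr => e e0; rewrite add0r.
  have /continuous_distP/(_ _ e0)[d0 d00 dE] := is_derive_continuous dh.
  have [s s01 sd] := small _ d00.
  have /dE : `|0 - s| < d0 by rewrite sub0r normrN gtr0_norm//; case/andP : s01.
  by rewrite (hE _ s01) subr0 => /ltW.
split=> //; apply/eqP; rewrite -normr_le0; apply/ler_addgt0Pr => e e0; rewrite add0r.
have [/= hc dE] := dh.
have /cvgrPdist_lt/(_ _ e0) : s^-1 *: (h (s *: (1 : R) + 0) - h 0) @[s --> 0^'] --> d.
  by rewrite -dE.
rewrite near_withinE => /nbhs_distP[d0 d00 dlt].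
have [s s01 sd] := small _ d00; have /andP[s0' _] := s01.
have := dlt s _ _; rewrite sub0r normrN gtr0_norm// => /(_ sd (lt0r_neq0 s0')).
by rewrite addr0 [s *: _]mulr1 (hE _ s01) h0 subr0 scaler0 subr0 => /ltW.
Qed.

Lemma flow_annihilator {n : nat} (X Y : 'rV[R]_n -> 'rV[R]_n) q N c phi V W
    (mu : 'cV[R]_n) (s0 : R) :
  0 < c -> local_flow X q N c phi V W -> smooth X -> smooth Y -> 0 < s0 ->
  (forall s, 0 < s < s0 -> Y (phi s q) *m W s *m mu = 0) ->
  Y q *m mu = 0 /\ lie_bracket X Y q *m mu = 0.
Proof.
move=> c0 lf Xs Ys s00 h0.
have dY := smooth_differentiable Ys.
have qc : `|q - q| < c by rewrite subrr normr0.
have n0 : `|0 : R| < c by rewrite normr0.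
have [dphi _] := flow_derive lf qc n0.
rewrite (flow_init lf) in dphi.
have dYphi := is_derive_diff_comp dphi (dY (phi 0 q)).
have dh := is_derive_mulmx (is_derive_mulmx dYphi (flow_inv_derive lf))
  (is_derive_cst mu (0 : R) (1 : R)).
have [] := is_derive_right0 s00 dh h0.
rewrite /= mulmx0 addr0 (flow_init lf) (flow_inv0 lf) !mulmx1 mulmxN => -> h.
split=> //; rewrite -h; congr (_ *m mu).
exact: (congr1 (fun M => 'd Y q (X q) - M) (diff_jacobian X q (Y q))).
Qed.

End RightDerivative.

Lemma row_free_col_mx {F : fieldType} {k n : nat} (x : 'rV[F]_n) (L : 'M[F]_(k, n)) :
  row_free L -> ~~ (x <= L)%MS -> row_free (col_mx x L).
Proof.
move=> Lf xL; rewrite /row_free eqn_leq rank_leq_row/=.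
have LxL : (L <= col_mx x L)%MS by rewrite -addsmxE addsmxSr.
have := mxrank_leqif_sup LxL; rewrite col_mx_sub submx_refl andbT (negbTE xL).
move=> [h1 h2]; have : (\rank L < \rank (col_mx x L))%N by rewrite ltn_neqAle h2/= h1.
by rewrite (eqP Lf).
Qed.

Lemma row_free_kernel {F : fieldType} {k n : nat} (L : 'M[F]_(k, n)) :
  (k < n)%N -> exists2 mu : 'cV[F]_n, mu != 0 & L *m mu = 0.
Proof.
move=> kn.
have : cokermx L != 0.
  rewrite -mxrank_eq0 mxrank_coker subn_eq0 -ltnNge.
  exact: leq_ltn_trans (rank_leq_row L) kn.
move=> /eqP/matrixP h.
have [j cj] : exists j, col j (cokermx L) != 0.
  apply: contrapT => nj; apply: h => i j; rewrite mxE.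
  have : col j (cokermx L) = 0 by apply/eqP/negPn/negP => ?; apply: nj; exists j.
  by move=> /matrixP/(_ i 0); rewrite !mxE.
by exists (col j (cokermx L)) => //; rewrite colE mulmxA mulmx_coker mul0mx.
Qed.

Section Accessibility.
Context {R : realType} {n m : nat}.
Variables (f0 : 'rV[R]_n -> 'rV[R]_n) (g : 'I_m -> 'rV[R]_n -> 'rV[R]_n).
Variables (ulo uhi : 'I_m -> 'rV[R]_n -> R).
Hypothesis f0_smooth : smooth f0.
Hypothesis g_smooth : forall i, smooth (g i).
Variables (u0 : 'rV[R]_m) (eps : R).
Hypothesis eps_gt0 : 0 < eps.

Definition ctrl (o : option 'I_m) : 'rV[R]_m :=
  if o is Some i then u0 + eps *: delta_mx 0 i else u0.

Definition frozen o (x : 'rV[R]_n) : 'rV[R]_n := rhs f0 g x (ctrl o).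

Lemma frozen_smooth o : smooth (frozen o).
Proof.
apply: (@smoothD _ _ _ f0 (fun x => \sum_(i < m) ctrl o 0 i *: g i x)) => //.
by apply: smooth_sum => i; exact: smoothZ.
Qed.

Lemma f0_frozen x :
  f0 x = frozen None x - \sum_(i < m) u0 0 i *: g i x.
Proof. by rewrite /frozen /rhs addrK. Qed.

Lemma g_frozen i x : g i x = eps^-1 *: (frozen (Some i) x - frozen None x).
Proof.
rewrite /frozen /rhs /ctrl opprD addrACA subrr add0r -sumrB.
rewrite (bigD1 i)//= big1 => [|j ji]; rewrite !mxE.
  rewrite !eqxx mulr1 addr0 -scalerBl addrAC subrr add0r.
  by rewrite scalerA mulVf ?scale1r// gt_eqF.
by rewrite (negbTE ji) andbF mulr0 addr0 subrr.
Qed.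

Variables (N : set 'rV[R]_n) (xe : 'rV[R]_n).
Hypothesis N_open : open N.
Hypothesis N_xe : N xe.
Hypothesis N_ctrl : forall o x, N x -> Omega ulo uhi x (ctrl o).

Lemma steered_flow o q c phi V W tau y s :
  local_flow (frozen o) q N c phi V W -> steered f0 g ulo uhi N xe tau y ->
  0 <= tau -> `|y - q| < c -> 0 <= s -> s < c ->
  steered f0 g ulo uhi N xe (tau + s) (phi s y).
Proof.
move=> lf st tau0 yq s0 sc; have [K Klip] := flow_lip lf.
apply: (@steered_step _ _ _ _ _ _ _ _ _ _ _ (phi^~ y) (ctrl o) _ K tau0 s0 st).
- exact: flow_init lf y.
- move=> a b a0 ab bs.
  have b0 := le_trans a0 ab.
  have := Klip y a b; rewrite !ger0_norm ?subr_ge0//; apply.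
    exact: le_lt_trans (le_trans ab bs) sc.
  exact: le_lt_trans bs sc.
move=> t /andP[t0 ts].
have tc : `|t| < c by rewrite ger0_norm// (le_lt_trans ts).
by have [dphi Nphi] := flow_derive lf yq tc; split=> //; exact: N_ctrl.
Qed.

Variable T : R.
Hypothesis T_gt0 : 0 < T.

(* The slack [T' < T] leaves time to append another flow. *)
Definition reached_immersion k (G : 'rV[R]_k -> 'rV[R]_n) p L : Prop :=
  [/\ row_free L, strict_diff G p L & exists T' d : R, [/\ T' < T, 0 < d &
    forall a, `|a - p| < d -> exists2 tau, 0 <= tau <= T' &
      steered f0 g ulo uhi N xe tau (G a)]].

Lemma reached_immersion_in k G p L : @reached_immersion k G p L -> N (G p).
Proof.
move=> [_ _ [T' [d [_ d0 /(_ p)]]]]; rewrite subrr normr0 => /(_ d0)[tau /andP[t0 _]].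
move=> [x [u [K [B [E [_ _ _ xN [_ <-]]]]]]]; apply: xN.
by rewrite t0 lexx.
Qed.

Lemma reached_immersion0 : @reached_immersion 0 (cst xe) 0 0.
Proof.
split; first by rewrite /row_free mxrank0.
  by move=> e e0; exists 1 => // a b _ _; rewrite mulmx0 !subrr normr0 mulr_ge0// ltW.
exists 0, 1; split=> // a _; exists 0; first by rewrite lexx.
exact: steered0.
Qed.

Lemma reached_immersion_flow k G p L o : @reached_immersion k G p L ->
  exists c phi V W s0, [/\ 0 < c, local_flow (frozen o) (G p) N c phi V W,
    0 < s0, s0 <= c & forall s, 0 <= s < s0 ->
      @reached_immersion k (phi s \o G) p (L *m V s) /\
      (0 < s -> row_free (col_mx (frozen o (phi s (G p))) (L *m V s)) ->
        exists G' p' L', @reached_immersion k.+1 G' p' L')].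
Proof.
move=> imG; have NGp := reached_immersion_in imG.
have [Lf GL [T' [d [T'T d0 GN]]]] := imG.
have nN : nbhs (G p) N by exact: open_nbhs_nbhs.
have [c [phi [V [W [c0 lf]]]]] := exists_local_flow (frozen_smooth o) nN.
pose s0 := Num.min c ((T - T') / 2).
have s00 : 0 < s0 by rewrite lt_min c0 divr_gt0// subr_gt0.
have s0c : s0 <= c by rewrite ge_min lexx.
exists c, phi, V, W, s0; split=> // s /andP[s_ge0 ss0].
have sc : s < c by exact: lt_le_trans ss0 s0c.
have nsc : `|s| < c by rewrite ger0_norm.
have Vu : row_free (V s).
  by rewrite row_free_unit; have [] := mulmx1_unit (flow_inv lf nsc).
have LVf : row_free (L *m V s) by rewrite /row_free mxrankMfree.
have [K [d1 [K0 d10 GK]]] := strict_diff_lip GL.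
have [d2 d20 Gc] : exists2 d2, 0 < d2 & forall a, `|a - p| < d2 -> `|G a - G p| < c.
  have K1 : 0 < K + 1 by rewrite ltr_wpDl.
  exists (Num.min d1 (c / (K + 1))); first by rewrite lt_min d10 divr_gt0.
  move=> a; rewrite lt_min => /andP[ad1]; rewrite ltr_pdivlMr// => aK.
  rewrite (le_lt_trans (GK _ _ ad1 _)) ?subrr ?normr0//.
  by rewrite (le_lt_trans _ aK)// mulrC ler_wpM2l// lerDl ler01.
have T'' : T' + (T - T') / 2 < T by lra.
have reach a t : `|a - p| < Num.min d d2 -> 0 <= t -> t < s0 ->
    exists2 tau, 0 <= tau <= T' + (T - T') / 2 &
      steered f0 g ulo uhi N xe tau (phi t (G a)).
  rewrite lt_min => /andP[ad ad2] t0; rewrite lt_min => /andP[tc tT].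
  have [tau /andP[tau0 tauT] st] := GN a ad.
  exists (tau + t); first by rewrite addr_ge0//= lerD// ltW.
  exact: (steered_flow lf st tau0 (Gc _ ad2) t0 tc).
have dd0 : 0 < Num.min d d2 by rewrite lt_min d0.
split.
  split=> //; first exact: strict_diff_flow lf GL (erefl _) nsc.
  by exists (T' + (T - T') / 2), (Num.min d d2); split=> // a ad; exact: reach.
move=> s_gt0 Mf.
exists (fun b : 'rV[R]_(1 + k) => phi (b 0 (lshift k 0)) (G (rsubmx b))).
exists (row_mx s%:M p), (col_mx (frozen o (phi s (G p))) (L *m V s)).
split=> //; first exact: strict_diff_flow_time lf GL (erefl _) nsc.
pose d3 := Num.min (Num.min d d2) (Num.min s (s0 - s)).
exists (T' + (T - T') / 2), d3; split=> //.
  by rewrite /d3 lt_min dd0 lt_min s_gt0 subr_gt0.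
move=> b'; pose b : 'rV[R]_(1 + k) := b'; rewrite -[b']/b /d3 lt_min => /andP[bd].
have bs : `|b 0 (lshift k 0) - s| <= `|b - row_mx s%:M p|.
  have -> : b 0 (lshift k 0) - s = (b - row_mx s%:M p) 0 (lshift k 0).
    by rewrite [RHS]mxE [X in _ = _ + X]mxE row_mxEl mxE eqxx mulr1n.
  exact: mx_coord_le.
have br : `|rsubmx b - p| <= `|b - row_mx s%:M p|.
  have -> : rsubmx b - p = rsubmx (b - row_mx s%:M p) by rewrite linearB/= row_mxKr.
  by apply: mx_norm_leP => // i j; rewrite mxE; exact: mx_coord_le.
rewrite lt_min => /andP[/(le_lt_trans bs) b1 /(le_lt_trans bs) b2].
apply: reach; first exact: le_lt_trans br bd.
  by move: b1; rewrite ltr_norml => /andP[+ _]; lra.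
by move: b2; rewrite ltr_norml => /andP[_]; lra.
Qed.

Section NoExtension.
Variable k : nat.
Hypothesis no_extension : ~ exists G p L, @reached_immersion k.+1 G p L.

Definition tangent (Y : 'rV[R]_n -> 'rV[R]_n) : Prop :=
  forall G p L, @reached_immersion k G p L ->
  forall mu : 'cV[R]_n, L *m mu = 0 -> Y (G p) *m mu = 0.

Lemma frozen_tangent o : tangent (frozen o).
Proof.
move=> G p L imG mu Lmu.
have [c [phi [V [W [s0 [c0 lf s00 s0c stepE]]]]]] := reached_immersion_flow o imG.
have Xs := frozen_smooth o.
apply: (flow_annihilator c0 lf Xs Xs s00 _).1 => s /andP[sgt0 ss0].
have s01 : 0 <= s < s0 by rewrite ltW.
have sc : `|s| < c by rewrite gtr0_norm// (lt_le_trans ss0).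
have [[LVf _ _] ext] := stepE s s01.
have : (frozen o (phi s (G p)) <= L *m V s)%MS.
  apply/negPn/negP => nsub; apply: no_extension; apply: ext => //.
  exact: row_free_col_mx.
move=> /submxP[D ->].
by rewrite -!mulmxA (mulmxA (V s)) (flow_inv lf sc) mul1mx Lmu mulmx0.
Qed.

Lemma tangent_bracket o Y : smooth Y -> tangent Y -> tangent (lie_bracket (frozen o) Y).
Proof.
move=> Ys Yt G p L imG mu Lmu.
have [c [phi [V [W [s0 [c0 lf s00 s0c stepE]]]]]] := reached_immersion_flow o imG.
apply: (flow_annihilator c0 lf (frozen_smooth o) Ys s00 _).2 => s /andP[sgt0 ss0].
have s01 : 0 <= s < s0 by rewrite ltW.
have sc : `|s| < c by rewrite gtr0_norm// (lt_le_trans ss0).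
have [imGs _] := stepE s s01.
rewrite -mulmxA; apply: (Yt _ _ _ imGs).
by rewrite -mulmxA (mulmxA (V s)) (flow_inv lf sc) mul1mx.
Qed.

Lemma tangent0 : tangent (cst 0).
Proof. by move=> G p L _ mu _; rewrite mul0mx. Qed.

Lemma tangentD X Y : tangent X -> tangent Y -> tangent (X \+ Y).
Proof.
by move=> Xt Yt G p L im mu h; rewrite mulmxDl (Xt _ _ _ im)// (Yt _ _ _ im)// addr0.
Qed.

Lemma tangentZ (a : R) X : tangent X -> tangent (fun x => a *: X x).
Proof. by move=> Xt G p L im mu h; rewrite -scalemxAl (Xt _ _ _ im)// scaler0. Qed.

Lemma tangentB X Y : tangent X -> tangent Y -> tangent (X \- Y).
Proof.
by move=> Xt Yt G p L im mu h; rewrite mulmxBl (Xt _ _ _ im)// (Yt _ _ _ im)// subr0.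
Qed.

(* By the Jacobi identity, these fields form a Lie algebra. *)
Definition tangent_preserving (Y : 'rV[R]_n -> 'rV[R]_n) : Prop :=
  [/\ smooth Y, tangent Y &
    forall Z, smooth Z -> tangent Z -> tangent (lie_bracket Y Z)].

Lemma tangent_preserving0 : tangent_preserving (cst 0).
Proof.
split; [exact: smooth_cst|exact: tangent0|move=> Z _ _].
by rewrite lie_bracket0l; exact: tangent0.
Qed.

Lemma tangent_preservingD X Y : tangent_preserving X -> tangent_preserving Y ->
  tangent_preserving (X \+ Y).
Proof.
move=> [Xs Xt XZ] [Ys Yt YZ]; split; [exact: smoothD|exact: tangentD|move=> Z Zs Zt].
by rewrite lie_bracketDl//; apply: tangentD; [exact: XZ|exact: YZ].
Qed.

Lemma tangent_preservingZ (a : R) X : tangent_preserving X ->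
  tangent_preserving (fun x => a *: X x).
Proof.
move=> [Xs Xt XZ]; split; [exact: smoothZ|exact: tangentZ|move=> Z Zs Zt].
by rewrite lie_bracketZl//; apply: tangentZ; exact: XZ.
Qed.

Lemma tangent_preservingB X Y : tangent_preserving X -> tangent_preserving Y ->
  tangent_preserving (fun x => X x - Y x).
Proof.
move=> Xp Yp; have -> : (fun x => X x - Y x) = X \+ (fun x => -1 *: Y x).
  by apply/funext => x; rewrite /= scaleN1r.
exact: tangent_preservingD Xp (tangent_preservingZ (-1) Yp).
Qed.

Lemma tangent_preserving_sum l (F : 'I_l -> 'rV[R]_n -> 'rV[R]_n) :
  (forall i, tangent_preserving (F i)) ->
  tangent_preserving (fun x => \sum_(i < l) F i x).
Proof.
move=> Fp; elim: (index_enum _) => [|i r ih].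
  rewrite (_ : (fun x => _) = cst 0); first exact: tangent_preserving0.
  by apply/funext => x; rewrite big_nil.
rewrite (_ : (fun x => _) = F i \+ (fun x => \sum_(j <- r) F j x)).
  exact: tangent_preservingD (Fp i) ih.
by apply/funext => x; rewrite big_cons.
Qed.

Lemma tangent_preserving_bracket X Y : tangent_preserving X -> tangent_preserving Y ->
  tangent_preserving (lie_bracket X Y).
Proof.
move=> [Xs Xt XZ] [Ys Yt YZ]; split; [exact: smooth_lie_bracket|exact: XZ|].
move=> Z Zs Zt; rewrite jacobi//; apply: tangentB.
  by apply: XZ; [exact: smooth_lie_bracket|exact: YZ].
by apply: YZ; [exact: smooth_lie_bracket|exact: XZ].
Qed.

Lemma tangent_preserving_frozen o : tangent_preserving (frozen o).
Proof.
split; [exact: frozen_smooth|exact: frozen_tangent|].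
by move=> Z; exact: tangent_bracket.
Qed.

Lemma lie_closure_tangent Y : lie_closure (sys_fields f0 g) Y -> tangent Y.
Proof.
have gp i : tangent_preserving (g i).
  rewrite (_ : g i = fun x => eps^-1 *: (frozen (Some i) x - frozen None x)).
    apply: tangent_preservingZ; apply: tangent_preservingB;
      exact: tangent_preserving_frozen.
  by apply/funext => x; exact: g_frozen.
have f0p : tangent_preserving f0.
  rewrite (_ : f0 = fun x => frozen None x - \sum_(i < m) u0 0 i *: g i x).
    apply: tangent_preservingB; first exact: tangent_preserving_frozen.
    by apply: tangent_preserving_sum => i; exact: tangent_preservingZ.
  by apply/funext => x; exact: f0_frozen.
have : lie_closure (sys_fields f0 g) `<=` tangent_preserving.
  apply: smallest_sub.
    split.
    - by move=> X [].
    - exact: tangent_preserving0.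
    - exact: tangent_preservingD.
    - exact: tangent_preservingZ.
    - exact: tangent_preserving_bracket.
  by move=> X [->|[i _ <-]]; [exact: f0p|exact: gp].
by move=> h /h[_].
Qed.

End NoExtension.

End Accessibility.

Lemma LARC_near {R : realType} {n : nat} (F : set ('rV[R]_n -> 'rV[R]_n)) xe :
  F `<=` smooth -> LARC F xe ->
  \forall x \near xe, forall mu : 'cV[R]_n,
    (forall Y, lie_closure F Y -> Y x *m mu = 0) -> mu = 0.
Proof.
move=> Fs rank.
have /choice[Y YE] : forall i : 'I_n, exists Y, lie_closure F Y /\ Y xe = delta_mx 0 i.
  by move=> i; have : [set: 'rV[R]_n] (delta_mx 0 i) by [];
    rewrite -rank => -[Y]; exists Y.
have Ys i : smooth (Y i).
  by apply: (smallest_sub lie_algebra_smooth Fs); exact: (YE i).1.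
pose D x : 'M[R]_n := \matrix_(i, j) Y i x 0 j.
have Dxe : D xe = 1%:M.
  by apply/matrixP => i j; rewrite !mxE (YE i).2 mxE eqxx eq_sym.
have Dc : {for xe, continuous D}.
  apply: (@cvg_mxP _ _ (nbhs xe) _) => i j; rewrite mxE.
  rewrite (_ : (fun x => D x i j) = fun x => Y i x 0 j).
    apply: (@continuous_comp _ _ _ (Y i) (fun M : 'rV[R]_n => M 0 j)).
      exact: smooth_continuous.
    exact: coord_continuous.
  by apply/funext => x; rewrite mxE.
have n1 : 0 < n%:R + 1 :> R by rewrite ltr_wpDl.
have en : 0 < (n%:R + 1)^-1 :> R by rewrite invr_gt0.
have /continuous_distP/(_ _ en)[d d0 dE] := Dc.
apply/nbhs_distP; exists d => // x /dE xd mu Ymu.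
have Dmu : D x *m mu = 0.
  apply/row_matrixP => i; rewrite row_mul row0.
  have -> : row i (D x) = Y i x by apply/rowP => j; rewrite !mxE.
  exact: Ymu (YE i).1.
have muE : mu = (D xe - D x) *m mu by rewrite mulmxBl Dxe mul1mx Dmu subr0.
apply/eqP; rewrite -normr_le0 leNgt; apply/negP => mu0.
have := mulmx_norm_le (D xe - D x) mu; rewrite -muE.
rewrite -[X in X <= _]mul1r ler_pM2r// leNgt => /negP; apply.
have nn : 0 <= n%:R :> R by [].
rewrite (le_lt_trans (ler_wpM2l nn (ltW xd)))// ltr_pdivrMr// mul1r ltrDl.
exact: ltr01.
Qed.

Lemma exists_reached_immersion {R : realType} {n m : nat}
  (f0 : 'rV[R]_n -> 'rV[R]_n) (g : 'I_m -> 'rV[R]_n -> 'rV[R]_n)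
  (ulo uhi : 'I_m -> 'rV[R]_n -> R) (u0 : 'rV[R]_m) (eps : R)
  (N : set 'rV[R]_n) (xe : 'rV[R]_n) (T : R) :
  smooth f0 -> (forall i, smooth (g i)) -> 0 < eps -> open N -> N xe ->
  (forall o x, N x -> Omega ulo uhi x (ctrl u0 eps o)) -> 0 < T ->
  (forall x, N x -> forall mu : 'cV[R]_n,
    (forall Y, lie_closure (sys_fields f0 g) Y -> Y x *m mu = 0) -> mu = 0) ->
  forall k, (k <= n)%N ->
  exists G p L, @reached_immersion _ _ _ f0 g ulo uhi N xe T k G p L.
Proof.
move=> f0s gs eps0 No Nxe Nctrl T0 rankN; elim=> [|k ih] kn.
  by exists (cst xe), 0, 0; exact: reached_immersion0.
have [G [p [L imG]]] := ih (ltnW kn).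
apply: contrapT => noext.
have [mu mu0 Lmu] := row_free_kernel L kn.
move/eqP : mu0; apply; apply: (rankN (G p)); first exact: reached_immersion_in imG.
move=> Y YL.
have Yt := lie_closure_tangent f0s gs eps0 No Nctrl noext YL.
exact: Yt imG _ Lmu.
Qed.

Lemma Omega_interior_near {R : realType} {n m : nat}
  (ulo uhi : 'I_m -> 'rV[R]_n -> R) (xe : 'rV[R]_n) (u0 : 'rV[R]_m) :
  (forall i, continuous (ulo i)) -> (forall i, continuous (uhi i)) ->
  (Omega ulo uhi xe)° u0 ->
  exists2 eps, 0 < eps & \forall x \near xe, forall o,
    Omega ulo uhi x (ctrl u0 eps o).
Proof.
move=> ulo_c uhi_c /nbhs_distP[d d0 dE].
pose e := d / 4; have e0 : 0 < e by rewrite divr_gt0.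
have delta_le (i : 'I_m) : `|delta_mx 0 i : 'rV[R]_m| <= 1.
  by apply: mx_norm_leP => // k l; rewrite mxE; case: (_ && _); rewrite ?normr0 ?normr1.
have bounds i : ulo i xe < u0 0 i - e /\ u0 0 i + e < uhi i xe.
  have in_ball (r : R) : `|r| < d -> Omega ulo uhi xe (u0 + r *: delta_mx 0 i).
    move=> rd; apply: dE; rewrite opprD addNKr normrN normrZ.
    by rewrite (le_lt_trans _ rd)// ler_piMr.
  have [h1 h2] : `|2 * e| < d /\ `|- (2 * e)| < d.
    by rewrite normrN gtr0_norm ?mulr_gt0// /e; split; lra.
  have := in_ball _ h1 i; have := in_ball _ h2 i.
  rewrite !mxE !eqxx !mulr1 => /andP[a _] /andP[_ b].
  by split; [apply: (le_lt_trans a)|apply: lt_le_trans b]; lra.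
exists e => //.
have : \forall x \near xe, forall i, ulo i x < u0 0 i /\ u0 0 i + e < uhi i x.
  apply: (@filter_forall _ 'I_m _ (nbhs xe) _) => i.
  have [lo hi] := bounds i.
  have lo' : 0 < u0 0 i - ulo i xe by lra.
  have hi' : 0 < uhi i xe - (u0 0 i + e) by rewrite subr_gt0.
  have /continuous_distP/(_ _ lo')[d1 d10 d1E] := ulo_c i xe.
  have /continuous_distP/(_ _ hi')[d2 d20 d2E] := uhi_c i xe.
  apply/nbhs_distP; exists (Num.min d1 d2); first by rewrite lt_min d10.
  move=> y; rewrite lt_min => /andP[/d1E y1 /d2E y2].
  move: y1 y2; rewrite !ltr_norml => /andP[y1 _] /andP[_ y2].
  by split; lra.
apply: filterS => x xE o i; have [lo hi] := xE i.
case: o => [j|] /=; rewrite ?mxE.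
  by case: (i == j) => /=; rewrite ?eqxx ?mulr1 ?mulr0 ?addr0; apply/andP; split; lra.
by apply/andP; split; lra.
Qed.

Theorem corollary1 (R : realType) (n m : nat)
  (f0 : 'rV[R]_n -> 'rV[R]_n) (g : 'I_m -> 'rV[R]_n -> 'rV[R]_n)
  (ulo uhi : 'I_m -> 'rV[R]_n -> R)
  (f0_smooth : smooth f0) (g_smooth : forall i, smooth (g i))
  (ulo_cont : forall i, continuous (ulo i))
  (uhi_cont : forall i, continuous (uhi i))
  (ulo_lt_uhi : forall i x, ulo i x < uhi i x)
  (same_sign : (forall i x, 0 < ulo i x) \/ (forall i x, uhi i x < 0))
  (xe : 'rV[R]_n)
  (balanced : balancing f0 g ulo uhi xe `&` (Omega ulo uhi xe)° !=set0)
  (rank_cond : LARC (sys_fields f0 g) xe) :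
  locally_accessible f0 g ulo uhi xe.
Proof.
have [u0 [_ u0_int]] := balanced.
have [eps eps0 ctrlE] := Omega_interior_near ulo_cont uhi_cont u0_int.
have Fs : sys_fields f0 g `<=` smooth.
  by move=> X [->|[i _ <-]]; [exact: f0_smooth|exact: g_smooth].
have rankE := LARC_near Fs rank_cond.
pose P := [set x : 'rV[R]_n | (forall o, Omega ulo uhi x (ctrl u0 eps o)) /\
  forall mu : 'cV[R]_n,
    (forall Y, lie_closure (sys_fields f0 g) Y -> Y x *m mu = 0) -> mu = 0].
have PP : nbhs xe P by apply: filterI ctrlE rankE.
exists P°; split=> [|T T0]; first by split; [exact: open_interior|].
have Nctrl o x : P° x -> Omega ulo uhi x (ctrl u0 eps o).
  by move=> /interior_subset[h _]; exact: h.
have Nrank x : P° x -> forall mu : 'cV[R]_n,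
    (forall Y, lie_closure (sys_fields f0 g) Y -> Y x *m mu = 0) -> mu = 0.
  by move=> /interior_subset[_ h]; exact: h.
have [G [p [L [Lf GL [T' [d [T'T d0 GN]]]]]]] := exists_reached_immersion
  f0_smooth g_smooth eps0 (open_interior P) PP Nctrl T0 Nrank (leqnn n).
apply: (strict_diff_interior _ GL d0); first by rewrite -row_free_unit.
move=> a /GN[tau /andP[tau0 tauT] st].
exact: steered_reachable tau0 (le_trans tauT (ltW T'T)) st.
Qed.
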